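(* Let $\chi$ be a primitive quadratic Dirichlet character modulo $q$. If $L(1,\chi)\ll (\log q)^{-26}$, then $$L'(1,\chi)=\frac{\pi^2}{6}\prod_{p\mid q}\left(1+\frac{1}{p}\right)\prod_{\substack{p\leqslant q\\ \chi(p)=1}}\left(1+\frac{1}{p}\right)\left(1-\frac{1}{p}\right)^{-1}\cdot\Big(1+\mathcal{O}\left((\log q)^{-1/10}\right)\Big).$$
   Context: $L(s,\chi)$ is the Dirichlet $L$-function of $\chi$ and $L'(s,\chi)$ its derivative in $s$. The letter $p$ denotes primes. The hypothesis $L(1,\chi)\ll(\log q)^{-26}$ means $L(1,\chi)\leqslant A(\log q)^{-26}$ for some constant $A>0$; the constant implied by $\mathcal{O}$ in the conclusion depends at most on $A$ (and not on $q$ or $\chi$). *)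

(* Defs.v *)
From HB Require Import structures.
From mathcomp Require Import all_boot all_order all_algebra.
From mathcomp Require Import all_classical all_reals all_analysis.
From mathcomp Require Import complex.

Set Implicit Arguments.
Unset Strict Implicit.
Unset Printing Implicit Defensive.

Import Order.TTheory GRing.Theory Num.Theory.
Import numFieldNormedType.Exports.

Local Open Scope classical_set_scope.
Local Open Scope ring_scope.
Local Open Scope complex_scope.

Section DirichletCharacters.
Variable K : fieldType.
Implicit Types (q d : nat) (chi : nat -> K).

(* A character of (Z/qZ)^* extended by zero, viewed as an arithmetic function.
   [chi 1 = 1] follows from the second and fourth fields. *)
Record dirichlet_character q chi : Prop := DirichletCharacter {
  dirichlet_modulus_gt0 : (0 < q)%N ;
  dirichletM : forall m n, chi (m * n)%N = chi m * chi n ;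
  dirichlet_periodic : forall n, chi (n + q)%N = chi n ;
  dirichlet_neq0 : forall n, (chi n != 0) = coprime n q }.

Definition principal_character q : nat -> K := fun n => (coprime n q)%:R.

(* The order of [chi] in the group of characters modulo [q] is exactly 2. *)
Definition quadratic_character q chi :=
  [/\ dirichlet_character q chi,
      forall n, chi n ^+ 2 = principal_character q n &
      chi <> principal_character q].

Definition induced_from q d chi :=
  exists2 psi : nat -> K, dirichlet_character d psi &
    forall n, coprime n q -> chi n = psi n.

Definition primitive_character q chi :=
  dirichlet_character q chi /\
  forall d, (d %| q)%N -> (d < q)%N -> ~ induced_from q d chi.

End DirichletCharacters.

Section DirichletLFunction.
Variable R : realType.

Definition cexp (z : R[i]) : R[i] :=
  let: x +i* y := z in (expR x * cos y) +i* (expR x * sin y).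

Definition nat_cpow (n : nat) (s : R[i]) : R[i] := cexp (s * (ln n%:R)%:C).

(* The Dirichlet series. For non-principal [chi] it converges (conditionally)
   on the whole half-plane [Re s > 0], where it is the L-function; outside the
   domain of convergence the value is a junk limit. The sum starts at 1. *)
Definition dirichlet_L (chi : nat -> R[i]) (s : R[i]) : R[i] :=
  lim ((fun N => \sum_(1 <= n < N.+1) chi n * nat_cpow n (- s) : (R[i])^o)
         @ \oo).

(* [derive1] over the base field [R[i]]: the complex derivative. *)
Definition dirichlet_L' (chi : nat -> R[i]) (s : R[i]) : R[i] :=
  derive1 (dirichlet_L chi : R[i] -> (R[i])^o) s.

End DirichletLFunction.

(* Main.v *)
(** With [lam = 1 * chi >= 0], partial summation gives, for [N >= q^3],
  [S(N) := sum_(n <= N) lam n / n = L(1)(ln N + gamma) + L'(1) + O(ln q ln N / q)].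
  If [L(1)] is tiny, [S] hardly grows between [q^3] and any power [q^B] with
  [B = O(ln q)].  Hence [L'(1)] is [S(q^4)] up to [O(1 / ln q)], and it remains
  to compare [S(q^4)] with the sum over all [q]-smooth [n], which is an Euler
  product.  The smooth [n > q^B] are negligible by Rankin's trick.  The
  non-smooth [n <= q^4] cost at most [exp(2 Q + 2 / q)] with
  [Q = sum_(q < p <= q^4) lam p / p], and [Q^4] is bounded by the increment of
  [S] between [q^4] and [2 q^16], so [Q = O(1 / ln q)].  The factor [pi^2 / 6]
  absorbs [prod_(p <= q) (1 - p^-2)^-1] up to [1 + O(1 / q)]. *)
Require Import Defs.
From HB Require Import structures.
From mathcomp Require Import all_boot all_order all_algebra.
From mathcomp Require Import all_classical all_reals all_analysis.
From mathcomp Require Import complex.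
From mathcomp Require Import ring lra zify.

Set Implicit Arguments.
Unset Strict Implicit.
Unset Printing Implicit Defensive.

Import Order.TTheory GRing.Theory Num.Theory.
Import numFieldNormedType.Exports.

Local Open Scope ring_scope.
Local Open Scope complex_scope.

Import ComplexField.Normc.

(** * The complex exponential *)

Section RealInequalities.
Variable R : realType.
Implicit Types x y : R.

(** The obstacle is that [S(N)] is under control only from [N = q^3] on, while primes just above [q]
    already produce non-smooth integers below that point. Hence the fourth power of [Q]: a product
    of four primes above [q] exceeds [q^4], where increments of [S] are small, and
    [lam_prime_mul_le] shows that such products keep enough weight even when primes repeat. Every
    comparison of sums rests on [lam >= 0]. Positivity also supplies a lower bound for [L(1)], which
    the hypothesis bounds only from above. Rankin's trick forces [B] of order [ln q]: the weighted
    smooth sum is a fixed power of [q], and the weight gained beyond [q^B] is only [exp(B / 4)]. An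
    increment of [S] up to [q^B] therefore carries a factor [ln^2 q], which the smallness of [L(1)]
    must absorb. Since [L(s, chi)] is given as a conditionally convergent series, its complex
    derivative at 1 is computed from a Taylor remainder of each term, summed by parts with complex
    weights. *)

Lemma ge0_of_derive_ge0 (f df : R -> R) (b : R) :
  (forall x, is_derive x 1 f (df x)) -> f 0 = 0 ->
  (forall x, 0 < x < b -> 0 <= df x) -> forall x, 0 <= x <= b -> 0 <= f x.
Proof.
move=> fd f0 df0 x /andP[]; rewrite le_eqVlt => /predU1P[<-|x0 xb].
  by rewrite f0.
have [|c] := @MVT R f df 0 x x0 (fun y _ => fd y).
  apply/continuous_subspaceT => y.
  by apply: differentiable_continuous; apply/derivable1_diffP.
rewrite in_itv/= f0 !subr0 => /andP[c0 cx] ->.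
by rewrite mulr_ge0 ?(ltW x0)// df0// c0 (lt_le_trans cx).
Qed.

Lemma sin_le_id x : 0 <= x -> sin x <= x.
Proof.
move=> x0; rewrite -subr_ge0.
apply: (@ge0_of_derive_ge0 (fun x => x - sin x) (fun x => 1 - cos x) x).
- by rewrite sin0 subr0.
- by move=> y _; rewrite subr_ge0 cos_le1.
- by rewrite x0 lexx.
Qed.

(** On [(0, pi/2)] this is [t <= tan t] without the denominator; it gives [1/sin^2 t <= 1 + 1/t^2]
    in the evaluation of zeta(2). *)
Lemma mul_cos_le_sin x : 0 <= x <= pi -> x * cos x <= sin x.
Proof.
move=> x0; rewrite -subr_ge0.
apply: (@ge0_of_derive_ge0 (fun x => sin x - x * cos x) (fun x => x * sin x) pi) => //.
- move=> y; apply: is_derive_eq; rewrite /GRing.scale /=.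
  by ring.
- by rewrite sin0 mul0r subr0.
- by move=> y /andP[y0 yp]; rewrite mulr_ge0 ?(ltW y0)// sin_ge0_pi// !ltW.
Qed.

Lemma onem_cos_le_id x : 0 <= x -> 1 - cos x <= x.
Proof.
move=> x0; rewrite -subr_ge0.
apply: (@ge0_of_derive_ge0 (fun x => x - (1 - cos x)) (fun x => 1 - sin x) x).
- by move=> y; apply: is_derive_eq; ring.
- by rewrite cos0 !subrr.
- by move=> y _; rewrite subr_ge0 sin_le1.
- by rewrite x0 lexx.
Qed.

Lemma subr_sin_le_sqr x : 0 <= x -> x - sin x <= x ^+ 2.
Proof.
move=> x0; rewrite -subr_ge0.
apply: (@ge0_of_derive_ge0 (fun x => x ^+ 2 - (x - sin x))
  (fun x => 2 * x - (1 - cos x)) x) => //.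
- move=> y; apply: is_derive_eq; rewrite /GRing.scale /=.
  by ring.
- by rewrite sin0 !subrr expr0n subrr.
- by move=> y /andP[y0 _]; have := onem_cos_le_id (ltW y0); lra.
- by rewrite x0 lexx.
Qed.

Lemma norm_sin_le x : `|sin x| <= `|x|.
Proof.
wlog x0 : x / 0 <= x => [H|].
  have [/H//|/ltW x0] := leP 0 x.
  by rewrite -normrN -sinN -(normrN x) H// oppr_ge0.
rewrite (ger0_norm x0) ler_norml sin_le_id// andbT.
have [x1|x1] := leP x 1; last by have := sin_geN1 x; lra.
have : 0 <= sin x.
  by rewrite sin_ge0_pi// x0 (le_trans x1)// (le_trans _ (pi_ge2 R))// ler1n.
lra.
Qed.

Lemma onem_cos_le_norm x : `|1 - cos x| <= `|x|.
Proof.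
have [x0|x0] := leP 0 x.
  by rewrite (ger0_norm x0) ger0_norm ?subr_ge0 ?cos_le1// onem_cos_le_id.
rewrite -cosN -(normrN x) ger0_norm ?subr_ge0 ?cos_le1//.
by rewrite ger0_norm ?oppr_ge0 ?(ltW x0)// onem_cos_le_id// oppr_ge0 ltW.
Qed.

Lemma onem_cos_le_sqr x : `|1 - cos x| <= x ^+ 2.
Proof.
rewrite ger0_norm ?subr_ge0 ?cos_le1//.
have -> : cos x = cos (x / 2 *+ 2) by congr cos; rewrite mulr2n; field.
rewrite cos_mulr2n cos2sin2.
have := norm_sin_le (x / 2).
rewrite -(ler_sqr (normr_ge0 _) (normr_ge0 _)) !real_normK ?num_real//.
by have := sqr_ge0 x; lra.
Qed.

Lemma norm_subr_sin_le x : `|x - sin x| <= x ^+ 2.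
Proof.
have [x0|/ltW x0] := leP 0 x.
  by rewrite ger0_norm ?subr_sin_le_sqr// subr_ge0 sin_le_id.
rewrite -normrN opprD -sinN -(sqrrN x) ger0_norm ?subr_sin_le_sqr ?oppr_ge0//.
by rewrite subr_ge0 sin_le_id// oppr_ge0.
Qed.

(** Multiply [1 - x <= expR (- x)] by [expR x]; the sign of [x] does not matter. *)
Lemma expRB1_le x : expR x - 1 <= x * expR x.
Proof.
have := expR_ge1Dx (- x); have := expRxMexpNx_1 x; have := expR_gt0 x.
move: (expR x) (expR (- x)) => a b; nra.
Qed.

Lemma norm_expRB1 x : `|expR x - 1| <= `|x| * expR `|x|.
Proof.
have [x0|/ltW x0] := leP 0 x.
  have h := expRB1_le x; rewrite !ger0_norm// ?subr_ge0//.
  by rewrite (le_trans _ (expR_ge1Dx x))// lerDl.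
rewrite (ler0_norm x0) distrC ger0_norm; last first.
  by rewrite subr_ge0 -expR0 ler_expR.
have := expR_ge1Dx x; have : 1 <= expR (- x).
  by rewrite -[leLHS]expR0 ler_expR; lra.
nra.
Qed.

Lemma norm_expRB1D x : `|expR x - 1 - x| <= x ^+ 2 * expR `|x|.
Proof.
have h1 := expR_ge1Dx x.
rewrite ger0_norm; last by lra.
have h2 := expRB1_le x.
have [x0|/ltW x0] := leP 0 x.
  by rewrite (ger0_norm x0); have := expR_gt0 x; nra.
have : 1 <= expR `|x| by rewrite -[leLHS]expR0 ler_expR.
nra.
Qed.

End RealInequalities.

Section ComplexExponential.
Variable R : realType.
Implicit Types z w : R[i].

Lemma cexpD z w : cexp (z + w) = cexp z * cexp w.
Proof.
case: z w => [x y] [x' y'] /=; rewrite /cexp expRD cosD sinD.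
by apply/eqP; rewrite eq_complex /=; apply/andP; split; apply/eqP; ring.
Qed.

Lemma normc_cexp z : normc (cexp z) = expR (complex.Re z).
Proof.
case: z => x y /=; rewrite !exprMn -mulrDr cos2Dsin2 mulr1 sqrtr_sqr.
by rewrite gtr0_norm ?expR_gt0.
Qed.

Lemma normc_ge0 z : 0 <= normc z.
Proof. by case: z => x y; rewrite sqrtr_ge0. Qed.

Lemma normc_real (x : R) : normc x%:C = `|x|.
Proof. by rewrite /= expr0n addr0 sqrtr_sqr. Qed.

Lemma normr_normcE z : `|z| = (normc z)%:C.
Proof. by rewrite normc_def; case: z. Qed.

Lemma normc_le_sum z : normc z <= `|complex.Re z| + `|complex.Im z|.
Proof.
case: z => x y /=; rewrite -[leRHS]ger0_norm ?addr_ge0// -sqrtr_sqr ler_wsqrtr//.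
rewrite sqrrD !real_normK ?num_real// lerD2r lerDl.
by rewrite mulrn_wge0// mulr_ge0.
Qed.

Lemma Re_le_normc z : `|complex.Re z| <= normc z.
Proof. by case: z => x y /=; rewrite -sqrtr_sqr ler_wsqrtr// lerDl sqr_ge0. Qed.

Lemma Im_le_normc z : `|complex.Im z| <= normc z.
Proof. by case: z => x y /=; rewrite -sqrtr_sqr ler_wsqrtr// lerDr sqr_ge0. Qed.

Lemma normc_sum (I : Type) (r : seq I) (P : pred I) (F : I -> R[i]) :
  normc (\sum_(i <- r | P i) F i) <= \sum_(i <- r | P i) normc (F i).
Proof.
elim/big_ind2 : _ => [|z a w b za wb|//]; first by rewrite normc0.
by rewrite (le_trans (le_normcD _ _))// lerD.
Qed.

Lemma normc_cexpB1 z : normc (cexp z - 1) <= 3 * normc z * expR (normc z).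
Proof.
rewrite (le_trans (normc_le_sum _))//.
have := Re_le_normc z; have := Im_le_normc z.
move: (normc_ge0 z); move: (normc z) => n n0.
case: z => x y /= yn xn; rewrite subr0.
have en : 1 <= expR n by rewrite -[leLHS]expR0 ler_expR.
have ex : expR `|x| <= expR n by rewrite ler_expR.
have ex' : expR x <= expR n by rewrite ler_expR (le_trans (ler_norm x)).
have -> : expR x * cos y - 1 = (expR x - 1) * cos y - (1 - cos y) by ring.
have h1 : `|(expR x - 1) * cos y| <= n * expR n.
  rewrite normrM (le_trans (ler_piMr _ (cos_max _)))//.
  by rewrite (le_trans (norm_expRB1 x))// ler_pM// expR_ge0.
have h2 : `|1 - cos y| <= n * expR n.
  by rewrite (le_trans (onem_cos_le_norm y))// (le_trans yn)// ler_peMr.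
have h3 : `|expR x * sin y| <= n * expR n.
  rewrite normrM mulrC ler_pM// ?(le_trans (norm_sin_le y))//.
  by rewrite gtr0_norm ?expR_gt0.
have := ler_normB ((expR x - 1) * cos y) (1 - cos y); lra.
Qed.

(** The real and imaginary parts split into four real products, each at most [n^2 * expR n] with
    [n = normc z]; hence the factor 4. *)
Lemma normc_cexpB1D z :
  normc (cexp z - 1 - z) <= 4 * normc z ^+ 2 * expR (normc z).
Proof.
rewrite (le_trans (normc_le_sum _))//.
have := Re_le_normc z; have := Im_le_normc z.
move: (normc_ge0 z); move: (normc z) => n n0.
case: z => x y /= yn xn; rewrite subr0.
have en : 1 + n <= expR n by rewrite expR_ge1Dx.
have en1 : 1 <= expR n by lra.
have ex : expR `|x| <= expR n by rewrite ler_expR.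
have ex' : expR x <= expR n by rewrite ler_expR (le_trans (ler_norm x)).
have y2 : y ^+ 2 <= n ^+ 2 by rewrite -real_normK ?num_real// ler_sqr ?nnegrE.
have x2 : x ^+ 2 <= n ^+ 2 by rewrite -real_normK ?num_real// ler_sqr ?nnegrE.
have n2 : 0 <= n ^+ 2 by rewrite sqr_ge0.
have -> : expR x * cos y - 1 - x = (expR x - 1 - x) * cos y - (1 + x) * (1 - cos y).
  by ring.
have -> : expR x * sin y - y = (expR x - 1) * sin y - (y - sin y) by ring.
have h1 : `|(expR x - 1 - x) * cos y| <= n ^+ 2 * expR n.
  rewrite normrM (le_trans (ler_piMr _ (cos_max _)))//.
  by rewrite (le_trans (norm_expRB1D x))// ler_pM// ?sqr_ge0 ?expR_ge0.
have h2 : `|(1 + x) * (1 - cos y)| <= n ^+ 2 * expR n.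
  rewrite normrM mulrC ler_pM//.
    by rewrite (le_trans (onem_cos_le_sqr y)).
  by rewrite (le_trans (ler_normD _ _))// normr1; lra.
have h3 : `|(expR x - 1) * sin y| <= n ^+ 2 * expR n.
  rewrite normrM mulrC expr2 -mulrA ler_pM//.
    by rewrite (le_trans (norm_sin_le y)).
  by rewrite (le_trans (norm_expRB1 x))// ler_pM// expR_ge0.
have h4 : `|y - sin y| <= n ^+ 2 * expR n.
  by rewrite (le_trans (norm_subr_sin_le y))// (le_trans y2)// ler_peMr.
have := ler_normB ((expR x - 1 - x) * cos y) ((1 + x) * (1 - cos y)).
have := ler_normB ((expR x - 1) * sin y) (y - sin y); lra.
Qed.

(** The norm on [R[i]] takes values in [R[i]], and a positive [eps] there is a real number by the
    definition of the order. This criterion moves complex limits to real ones once and for all. *)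
Lemma cvg_normc (u : nat -> R[i]) (l : R[i]) (e : nat -> R) :
  (e @ \oo --> (0 : R))%classic -> (forall n, normc (l - u n) <= e n) ->
  (u @ \oo --> (l : (R[i])^o))%classic.
Proof.
move=> e0 ue; apply/(@cvgrPdist_lt R[i] (R[i])^o) => eps.
case: eps => a b; rewrite ltcE /= => /andP[/eqP -> a0].
move/cvgrPdist_lt : e0 => /(_ a a0); apply: filterS => n.
rewrite sub0r normrN normr_normcE ltcR; apply: le_lt_trans.
by rewrite (le_trans (ue n))// ler_norm.
Qed.

Lemma normc_zero : normc (0 : R[i]) = 0.
Proof. exact: normc0. Qed.

Lemma normc_cvg (u : nat -> R[i]) (l : R[i]) :
  (u @ \oo --> (l : (R[i])^o))%classic ->
  ((fun n => normc (l - u n)) @ \oo --> (0 : R))%classic.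
Proof.
move=> /(@cvgrPdist_lt R[i] (R[i])^o) ul; apply/cvgrPdist_lt => e e0.
have := ul e%:C; rewrite ltcR => /(_ e0); apply: filterS => n.
by rewrite normr_normcE ltcR sub0r normrN ger0_norm ?normc_ge0.
Qed.

Lemma cvgcD (u v : nat -> R[i]) (l k : R[i]) :
  (u @ \oo --> (l : (R[i])^o))%classic -> (v @ \oo --> (k : (R[i])^o))%classic ->
  ((fun n => u n + v n) @ \oo --> (l + k : (R[i])^o))%classic.
Proof.
move=> /normc_cvg ul /normc_cvg vk.
apply: (@cvg_normc _ _ (fun n => normc (l - u n) + normc (k - v n))).
  by rewrite -[X in (_ --> X)%classic](addr0 0); apply: cvgD.
by move=> n; rewrite opprD addrACA le_normcD.
Qed.

Lemma cvgcZ (c : R[i]) (u : nat -> R[i]) (l : R[i]) :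
  (u @ \oo --> (l : (R[i])^o))%classic ->
  ((fun n => c * u n) @ \oo --> (c * l : (R[i])^o))%classic.
Proof.
move=> /normc_cvg ul; apply: (@cvg_normc _ _ (fun n => normc c * normc (l - u n))).
  by rewrite -[X in (_ --> X)%classic](mulr0 (normc c)); apply: cvgM => //; exact: cvg_cst.
by move=> n; rewrite -mulrBr normcM.
Qed.

(** The rate survives in the limit, which yields explicit tails for the series at 1, for Euler's
    constant and for zeta(2). *)
Lemma cauchy_cvg_rate (u e : nat -> R) : (e @ \oo --> (0 : R))%classic ->
  (forall m n, (m <= n)%N -> `|u n - u m| <= e m) ->
  exists2 l, (u @ \oo --> l)%classic & forall m, `|l - u m| <= e m.
Proof.
move=> e0 ue.
have cu : cvgn u.
  apply/cauchy_cvgP/cauchy_ballP => eps eps0; rewrite near_map2.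
  have /cvgrPdist_lt/(_ (eps / 2)) := e0; rewrite divr_gt0// => /(_ isT) H.
  near=> i j; rewrite /ball /=.
  have H1 : forall i j, (i <= j)%N -> `|0 - e i| < eps / 2 -> `|u i - u j| < eps.
    move=> a c ac; rewrite sub0r normrN => /(le_lt_trans (ler_norm _)) ea.
    by rewrite distrC (le_lt_trans (ue _ _ ac))//; lra.
  have [ij|/ltnW ij] := leqP i j.
    by apply: H1 => //; near: i; exact: H.
  by rewrite distrC; apply: H1 => //; near: j; exact: H.
exists (limn u) => // m; rewrite ler_distl; apply/andP; split.
  apply: limr_ge => //; exists m => // n /= mn.
  by have := ue _ _ mn; rewrite ler_distl => /andP[].
apply: limr_le => //; exists m => // n /= mn.
by have := ue _ _ mn; rewrite ler_distl => /andP[].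
Unshelve. all: by end_near.
Qed.

(** The factor 2 comes from treating real and imaginary parts separately. *)
Lemma cauchy_cvg_ratec (u : nat -> R[i]) (e : nat -> R) :
  (e @ \oo --> (0 : R))%classic ->
  (forall m n, (m <= n)%N -> normc (u n - u m) <= e m) ->
  exists2 l, (u @ \oo --> (l : (R[i])^o))%classic &
    forall m, normc (l - u m) <= 2 * e m.
Proof.
move=> e0 ue.
have [m n mn|a _ ua] := @cauchy_cvg_rate (fun n => complex.Re (u n)) e e0.
  apply: le_trans (ue _ _ mn); have := Re_le_normc (u n - u m).
  by case: (u n) (u m) => ? ? [].
have [m n mn|b _ ub] := @cauchy_cvg_rate (fun n => complex.Im (u n)) e e0.
  apply: le_trans (ue _ _ mn); have := Im_le_normc (u n - u m).
  by case: (u n) (u m) => ? ? [].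
have uab m : normc ((a +i* b) - u m) <= 2 * e m.
  rewrite (le_trans (normc_le_sum _))//.
  by have := ua m; have := ub m; case: (u m) => x y /=; lra.
exists (a +i* b) => //; apply: cvg_normc uab.
by rewrite -[X in (_ --> X)%classic](mulr0 2); apply: cvgM => //; exact: cvg_cst.
Qed.

End ComplexExponential.

(** * Summation by parts and L(s, chi) near s = 1 *)

Section AbelSummation.

Lemma abel_identity (K : comRingType) (x a : nat -> K) (m N : nat) : (m <= N)%N ->
  \sum_(m <= n < N.+1) x n * a n =
  (\sum_(m <= n < N.+1) x n) * a N +
  \sum_(m <= n < N) (\sum_(m <= k < n.+1) x k) * (a n - a n.+1).
Proof.
move=> /subnKC <-; elim: (N - m)%N => [|k IH].
  by rewrite addn0 !big_nat1 (big_geq (leqnn _)) addr0.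
rewrite addnS big_nat_recr/=; last by rewrite ltnW// ltnS leq_addr.
rewrite IH [in RHS]big_nat_recr/=; last by rewrite ltnW// ltnS leq_addr.
rewrite [X in _ = _ + X]big_nat_recr/= ?leq_addr//.
by ring.
Qed.

Variables (R : realType) (x : nat -> R) (B : R).
Hypothesis xB : forall N, `|\sum_(1 <= n < N) x n| <= B.

Lemma norm_sum_range m N : (0 < m)%N -> `|\sum_(m <= n < N) x n| <= 2 * B.
Proof.
move=> m0; have [mN|Nm] := leqP m N; last first.
  rewrite big_geq ?(ltnW Nm)// normr0 mulr_ge0// (le_trans _ (xB 0))//.
have -> : \sum_(m <= n < N) x n = \sum_(1 <= n < N) x n - \sum_(1 <= n < m) x n.
  by rewrite (big_cat_nat m0 mN) /= addrC addrK.
have := ler_normB (\sum_(1 <= n < N) x n) (\sum_(1 <= n < m) x n).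
have := xB m; have := xB N; lra.
Qed.

(** After summation by parts the weights are [a N] and the nonnegative drops [a n - a n.+1], whose
    total telescopes to [a m]. *)
Lemma abel_monotone (a : nat -> R) m N : (0 < m)%N ->
  (forall n, (m <= n)%N -> 0 <= a n.+1 <= a n) ->
  `|\sum_(m <= n < N) x n * a n| <= 2 * B * a m.
Proof.
move=> m0 am.
have B0 : 0 <= B by rewrite (le_trans _ (xB 0)).
have a0 n : (m <= n)%N -> 0 <= a n.
  by move=> mn; have /andP[/le_trans] := am n mn; apply.
case: N => [|N]; first by rewrite big_geq// normr0 mulr_ge0 ?mulr_ge0 ?a0.
have [mN|Nm] := leqP m N; last first.
  by rewrite big_geq// normr0 mulr_ge0 ?mulr_ge0 ?a0.
rewrite abel_identity// (le_trans (ler_normD _ _))//.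
have -> : 2 * B * a m = 2 * B * a N + \sum_(m <= n < N) 2 * B * (a n - a n.+1).
  rewrite -mulr_sumr -mulrDr.
  under eq_bigr do rewrite -opprB.
  by rewrite sumrN telescope_sumr// opprB addrC subrK.
apply: lerD.
  by rewrite normrM (ger0_norm (a0 _ mN)) ler_wpM2r ?a0// norm_sum_range.
rewrite (le_trans (ler_norm_sum _ _ _))// big_nat [leRHS]big_nat.
apply: ler_sum => n /andP[mn nN]; rewrite normrM (ger0_norm (x := _ - _)).
  by rewrite ler_wpM2r ?norm_sum_range// subr_ge0; case/andP: (am n mn).
by rewrite subr_ge0; case/andP: (am n mn).
Qed.

(** For complex weights monotonicity is replaced by total variation. *)
Lemma abel_normc (a : nat -> R[i]) m N : (0 < m)%N -> (m <= N)%N ->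
  normc (\sum_(m <= n < N.+1) (x n)%:C * a n) <=
  2 * B * (normc (a N) + \sum_(m <= n < N) normc (a n - a n.+1)).
Proof.
move=> m0 mN; rewrite abel_identity// (le_trans (le_normcD _ _))// mulrDr.
have H n : normc (\sum_(m <= k < n) (x k)%:C) <= 2 * B.
  by rewrite -rmorph_sum normc_real norm_sum_range.
apply: lerD; first by rewrite normcM ler_wpM2r ?normc_ge0.
rewrite (le_trans (normc_sum _ _ _))// mulr_sumr; apply: ler_sum => n _.
by rewrite normcM ler_wpM2r ?normc_ge0.
Qed.

End AbelSummation.

Section LogarithmSequences.
Variable R : realType.

Lemma ln_le_sqrt (t : R) : 0 < t -> ln t <= 2 * Num.sqrt t.
Proof.
move=> t0; have s0 : 0 < Num.sqrt t by rewrite sqrtr_gt0.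
rewrite -[in ln t](sqr_sqrtr (ltW t0)) lnXn// mulr2n.
by have := ln_sublinear s0; lra.
Qed.

Lemma ln_succ_sub (n : nat) : (0 < n)%N ->
  0 <= ln (n.+1%:R : R) - ln n%:R <= n%:R^-1.
Proof.
move=> n0; have n0' : (0 : R) < n%:R by rewrite ltr0n.
rewrite subr_ge0 ler_ln ?posrE ?ltr0n// ler_nat leqnSn/=.
rewrite -ln_div ?posrE ?ltr0n//.
have -> : n.+1%:R / n%:R = 1 + n%:R^-1 :> R by rewrite -natr1; field; lra.
by rewrite le_ln1Dx// (lt_trans _ (_ : 0 < n%:R^-1))// ?invr_gt0// ltrN10.
Qed.

(** [ln n / n] still rises up to [n = 3]; adding [1 / n] makes it decrease from [n = 1] on, so that
    [abel_monotone] applies to both [(1 + ln n) / n] and [1 / n], whose difference is [ln n / n]. *)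
Lemma onepln_div_nonincreasing (n : nat) : (0 < n)%N ->
  0 <= (1 + ln n.+1%:R) / (n.+1%:R : R) <= (1 + ln n%:R) / (n%:R : R).
Proof.
move=> n0; have n0' : (0 : R) < n%:R by rewrite ltr0n.
have l0 : 0 <= ln (n%:R : R) by rewrite ln_ge0// ler1n.
have l1 : 0 <= ln (n.+1%:R : R) by rewrite ln_ge0// ler1n.
apply/andP; split; first by rewrite divr_ge0// addr_ge0.
rewrite ler_pdivrMr ?ltr0n// mulrAC ler_pdivlMr//.
have /andP[_] := ln_succ_sub n0; rewrite -natr1 -(ler_pM2r n0') mulVf ?gt_eqF//.
nra.
Qed.

Lemma cvg_inv_sqrt : ((fun n => (Num.sqrt (n.+1%:R : R))^-1) @ \oo --> (0 : R))%classic.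
Proof.
have -> : (fun n => (Num.sqrt (n.+1%:R : R))^-1) = Num.sqrt \o harmonic.
  by apply/funext => n /=; rewrite sqrtrV.
rewrite -[X in (_ --> X)%classic]sqrtr0; apply: continuous_cvg.
  exact: sqrt_continuous.
exact: cvg_harmonic.
Qed.

Lemma twopln_div_le (n : nat) :
  (2 + ln n.+1%:R) / n.+1%:R <= 4 * (Num.sqrt (n.+1%:R : R))^-1.
Proof.
have n0' : (0 : R) < n.+1%:R by rewrite ltr0n.
rewrite ler_pdivrMr// -[X in _ * X](sqr_sqrtr (ltW n0')).
have s1 : 1 <= Num.sqrt (n.+1%:R : R) by rewrite -[leLHS]sqrtr1 ler_wsqrtr// ler1n.
have := ln_le_sqrt n0'; move: (Num.sqrt n.+1%:R) s1 => s s1.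
by rewrite expr2 mulrA mulfVK ?gt_eqF//; lra.
Qed.

Lemma cvg_twopln_div (B : R) :
  ((fun n => B * ((2 + ln n.+1%:R) / n.+1%:R)) @ \oo --> (0 : R))%classic.
Proof.
rewrite -[X in (_ --> X)%classic](mulr0 B); apply: cvgM; first exact: cvg_cst.
apply: (@squeeze_cvgr _ _ _ _ (fun=> 0) (fun n => 4 * (Num.sqrt (n.+1%:R : R))^-1)).
- apply: nearW => n; rewrite twopln_div_le andbT divr_ge0// addr_ge0// ln_ge0//.
  by rewrite ler1n.
- exact: cvg_cst.
- by rewrite -[X in (_ --> X)%classic](mulr0 4); apply: cvgM; [exact: cvg_cst|exact: cvg_inv_sqrt].
Qed.

End LogarithmSequences.

Section SeriesNearOne.
Variables (R : realType) (x : nat -> R) (B : R).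
Hypothesis xB : forall N, `|\sum_(1 <= n < N) x n| <= B.

Lemma sum_range_cat (V : zmodType) (F : nat -> V) m n : (m <= n)%N ->
  \sum_(1 <= k < n.+1) F k - \sum_(1 <= k < m.+1) F k = \sum_(m.+1 <= k < n.+1) F k.
Proof.
by move=> mn; rewrite (@big_cat_nat _ _ _ m.+1 1 n.+1)//= addrC addrK.
Qed.

Lemma partial_sum_bound_ge0 : 0 <= B. Proof. by rewrite (le_trans _ (xB 0)). Qed.

(** Abel summation gives the rate [2 * B / (m + 1)]; the larger one is stated so that this series
    and the one with logarithms share the same rate. *)
Lemma cvg_series_inv : exists2 l : R,
  ((fun N => \sum_(1 <= n < N.+1) x n * n%:R^-1) @ \oo --> l)%classic &
  forall m, `|l - \sum_(1 <= n < m.+1) x n * n%:R^-1| <=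
    2 * B * ((2 + ln m.+1%:R) / m.+1%:R).
Proof.
apply: cauchy_cvg_rate; first exact: cvg_twopln_div.
move=> m n mn; rewrite sum_range_cat//.
rewrite (le_trans (@abel_monotone _ _ _ xB (fun n => n%:R^-1) m.+1 n.+1 _ _))//.
  move=> k mk; rewrite invr_ge0 ler0n/= lef_pV2 ?posrE ?ltr0n ?(leq_trans _ mk)//.
  by rewrite ler_nat.
rewrite ler_wpM2l ?mulr_ge0 ?partial_sum_bound_ge0// ler_peMl ?invr_ge0//.
by have := @ln_ge0 R m.+1%:R; rewrite ler1n => /(_ isT); lra.
Qed.

Lemma cvg_series_ln : exists2 l : R,
  ((fun N => \sum_(1 <= n < N.+1) x n * (ln n%:R / n%:R)) @ \oo --> l)%classic &
  forall m, `|l - \sum_(1 <= n < m.+1) x n * (ln n%:R / n%:R)| <=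
    2 * B * ((2 + ln m.+1%:R) / m.+1%:R).
Proof.
apply: cauchy_cvg_rate; first exact: cvg_twopln_div.
move=> m n mn; rewrite sum_range_cat//.
have -> : \sum_(m.+1 <= k < n.+1) x k * (ln k%:R / k%:R) =
  \sum_(m.+1 <= k < n.+1) x k * ((1 + ln k%:R) / k%:R) -
  \sum_(m.+1 <= k < n.+1) x k * k%:R^-1.
  by rewrite -sumrB; apply: eq_bigr => k _; ring.
rewrite (le_trans (ler_normB _ _))//.
have -> : 2 * B * ((2 + ln m.+1%:R) / m.+1%:R) =
  2 * B * ((1 + ln m.+1%:R) / m.+1%:R) + 2 * B * m.+1%:R^-1 by ring.
apply: lerD.
  apply: (abel_monotone xB (a := fun k => (1 + ln k%:R) / k%:R)) => // k mk.
  by rewrite onepln_div_nonincreasing// (leq_trans _ mk).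
apply: (abel_monotone xB (a := fun k => k%:R^-1)) => // k mk.
rewrite invr_ge0 ler0n/= lef_pV2 ?posrE ?ltr0n ?(leq_trans _ mk)//.
by rewrite ler_nat.
Qed.

(* Second-order Taylor remainder at [h = 0] of [h |-> n^(-1-h)]. *)
Definition cpow_rem (h : R[i]) (n : nat) : R[i] :=
  (n%:R^-1)%:C * (cexp (- h * (ln n%:R)%:C) - 1 - (- h * (ln n%:R)%:C)).

Lemma sqr_ln_expR (u : R) : 0 <= u -> u ^+ 2 <= 64 * expR (u / 4).
Proof.
move=> u0; have := expR_ge1Dx (u / 8); have -> : u / 4 = 2%:R * (u / 8) by field.
rewrite expRM_natl; move: (expR _) => e h.
have : u / 8 <= e by lra.
rewrite -(@ler_sqr _ (u / 8)) ?nnegrE ?divr_ge0//; last by lra.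
by rewrite expr_div_n; lra.
Qed.

Lemma expR_half_ln (n : nat) : (0 < n)%N -> expR (ln n%:R / 2) = Num.sqrt n%:R :> R.
Proof.
move=> n0; apply/eqP; rewrite -(eqrXn2 (n := 2))// ?expR_ge0 ?sqrtr_ge0//.
rewrite sqr_sqrtr ?ler0n// -expRM_natl (_ : 2%:R * _ = ln n%:R); last by field.
by rewrite lnK// posrE ltr0n.
Qed.

(** For [normc h <= 1/4] the exponential factor costs at most [n^(1/4)], and [ln^2 n] costs at most
    [64 * n^(1/4)]; together with the 4 of [normc_cexpB1D] this is [256 * sqrt n]. After division by
    [n] the remainder still decays like [n^(-1/2)]. *)
Lemma normc_cexp_rem_ln (h : R[i]) (n : nat) : (0 < n)%N -> normc h <= 4^-1 ->
  normc (cexp (- h * (ln n%:R)%:C) - 1 - (- h * (ln n%:R)%:C)) <=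
  256 * normc h ^+ 2 * Num.sqrt n%:R.
Proof.
move=> n0 h4; rewrite (le_trans (normc_cexpB1D _))//.
have u0 : 0 <= ln (n%:R : R) by rewrite ln_ge0// ler1n.
rewrite normcM normcN normc_real (ger0_norm u0) -expR_half_ln//.
move: (ln n%:R) u0 (normc_ge0 h) => u u0 t0.
have := sqr_ln_expR u0.
have -> : u / 2 = u / 4 + u / 4 by field.
rewrite expRD.
have : expR (normc h * u) <= expR (u / 4) by rewrite ler_expR mulrC ler_wpM2l.
have := expR_ge0 (u / 4); have := expR_ge0 (normc h * u).
have := sqr_ge0 u; have := sqr_ge0 (normc h).
rewrite exprMn; move: (normc h ^+ 2) (u ^+ 2) (expR _) (expR _) => a b c d.
move=> a0 b0 c0 d0 cd bd.
have : b * d <= 64 * c * c by rewrite ler_pM.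
by move/(ler_wpM2l a0); lra.
Qed.

Lemma sqrt_succ_le (n : nat) : (0 < n)%N ->
  Num.sqrt (n.+1%:R : R) <= 2 * Num.sqrt n%:R.
Proof.
move=> n0; have -> : (2 : R) = Num.sqrt (2 ^+ 2) by rewrite sqrtr_sqr ger0_norm.
rewrite -sqrtrM ?exprn_ge0// ler_wsqrtr// -natrX -natrM ler_nat.
by case: n n0 => // n _; rewrite (_ : 2 ^ 2 = 4)%N// !mulnS; lia.
Qed.

(** The bound is a difference of consecutive values of [n^(-1/2)], so that the total variation
    needed in [abel_normc] telescopes. *)
Lemma cpow_rem_diff (h : R[i]) (n : nat) : (0 < n)%N -> normc h <= 4^-1 ->
  normc (cpow_rem h n - cpow_rem h n.+1) <=
  600 * normc h ^+ 2 * ((Num.sqrt n%:R)^-1 - (Num.sqrt n.+1%:R)^-1).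
Proof.
move=> n0 h4; rewrite /cpow_rem.
have rem1 := normc_cexp_rem_ln n0 h4.
have n1 : (1 : R) <= n%:R by rewrite ler1n.
have u0 : 0 <= ln (n.+1%:R : R) by rewrite ln_ge0// ler1n.
have /andP[d0 d1] := @ln_succ_sub R n n0.
set a := - h * (ln n%:R)%:C in rem1 *; set b := - h * (ln n.+1%:R)%:C.
have hab : a - b = h * (ln n.+1%:R - ln n%:R)%:C by rewrite /a /b rmorphB; ring.
have nab : normc (a - b) <= normc h * n%:R^-1.
  by rewrite hab normcM normc_real ger0_norm// ler_wpM2l ?normc_ge0.
(* The first term carries the change of [1/n]. The second carries the change of the remainder,
   through [e^a - e^b - d = e^b (e^d - 1 - d) + (e^b - 1) d] with [d = a - b], both parts of which
   are of order [normc h ^+ 2 / n] up to a factor [s']. *)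
have -> : (n%:R^-1)%:C * (cexp a - 1 - a) - (n.+1%:R^-1)%:C * (cexp b - 1 - b) =
  (n%:R^-1 - n.+1%:R^-1)%:C * (cexp a - 1 - a) +
  (n.+1%:R^-1)%:C * (cexp b * (cexp (a - b) - 1 - (a - b)) + (cexp b - 1) * (a - b)).
  have -> : cexp a = cexp b * cexp (a - b) by rewrite -cexpD addrC subrK.
  by rewrite rmorphB; ring.
rewrite (le_trans (le_normcD _ _))// !normcM !normc_real.
have nb : normc b = normc h * ln n.+1%:R.
  by rewrite /b normcM normcN normc_real ger0_norm.
have t0 := normc_ge0 h; set t := normc h in h4 rem1 nab nb t0 *.
set s := Num.sqrt n%:R in rem1 *; set s' := Num.sqrt n.+1%:R.
have s1 : 1 <= s by rewrite -[leLHS]sqrtr1 ler_wsqrtr.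
have ss' : s <= s' by rewrite ler_wsqrtr// ler_nat.
have s's : s' <= 2 * s := sqrt_succ_le n0.
have nE : n%:R = s ^+ 2 by rewrite sqr_sqrtr.
have nE' : n.+1%:R = s' ^+ 2 by rewrite sqr_sqrtr.
have ea : expR (normc b) <= s'.
  rewrite /s' -expR_half_ln// ler_expR nb mulrC ler_wpM2l//; lra.
have term2 : normc (cexp b * (cexp (a - b) - 1 - (a - b))) <= 8 * t ^+ 2 * s' / n%:R.
  rewrite normcM mulrC normc_cexp.
  have h1 : expR (complex.Re b) <= s'.
    by rewrite (le_trans _ ea)// ler_expR (le_trans (ler_norm _))// Re_le_normc.
  have h2 : normc (cexp (a - b) - 1 - (a - b)) <= 8 * t ^+ 2 / n%:R.
    rewrite (le_trans (normc_cexpB1D _))//.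
    have h3 : normc (a - b) <= 4^-1.
      by rewrite (le_trans nab)// (le_trans _ h4)// ler_piMr// invf_le1//; lra.
    have h4' : expR (normc (a - b)) <= 2.
      rewrite (@le_trans _ _ (expR 4^-1)) ?ler_expR//.
      by have := @expRB1_le R 4^-1; lra.
    have h5 : normc (a - b) ^+ 2 <= t ^+ 2 / n%:R.
      rewrite expr2 (@le_trans _ _ ((t / n%:R) * t))//; last by rewrite expr2; lra.
      rewrite ler_pM ?normc_ge0//.
      by rewrite (le_trans nab)// ler_piMr// invf_le1//; lra.
    rewrite -[leLHS]mulrA -[leRHS]mulrA.
    have := sqr_ge0 (normc (a - b)); have := expR_ge0 (normc (a - b)).
    move: (t ^+ 2 / n%:R) (normc (a - b) ^+ 2) (expR _) h5 h4'.
    move=> A D E AD E2 E0 D0; have : D * E <= A * 2 by rewrite ler_pM.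
    lra.
  rewrite [leRHS](_ : _ = 8 * t ^+ 2 / n%:R * s'); last by ring.
  by rewrite ler_pM ?normc_ge0 ?expR_ge0.
have term3 : normc ((cexp b - 1) * (a - b)) <= 12 * t ^+ 2 * s' / n%:R.
  rewrite normcM [leRHS](_ : _ = 12 * t * s' * (t / n%:R)); last by ring.
  rewrite ler_pM ?normc_ge0// (le_trans (normc_cexpB1 _))// nb.
  have h1 : expR (t * ln n.+1%:R) <= expR (ln n.+1%:R / 4).
    by rewrite ler_expR mulrC ler_wpM2l.
  have h2 : ln n.+1%:R <= 4 * expR (ln (n.+1%:R : R) / 4).
    by have := @expR_ge1Dx R (ln n.+1%:R / 4); lra.
  have -> : s' = expR (ln n.+1%:R / 4) * expR (ln n.+1%:R / 4).
    by rewrite /s' -expR_half_ln// -expRD; congr expR; field.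
  rewrite -!mulrA [leLHS](_ : _ = 3 * (t * (ln n.+1%:R * expR (t * ln n.+1%:R)))); last by ring.
  rewrite [leRHS](_ : _ = 3 * (t * ((4 * expR (ln (n.+1%:R : R) / 4)) *
    expR (ln (n.+1%:R : R) / 4)))); last by ring.
  by rewrite ler_wpM2l// ler_wpM2l// ler_pM// expR_ge0.
have term23 := lerD term2 term3.
have {}term23 := le_trans (le_normcD _ _) term23.
have T0 : 0 <= t ^+ 2 := sqr_ge0 t.
have s'0 : 0 < s' by lra.
have s0 : 0 < s by lra.
rewrite (ger0_norm (x := _ - _)); last first.
  by rewrite subr_ge0 lef_pV2 ?posrE ?ltr0n// ler_nat.
rewrite (ger0_norm (x := _^-1)); last by rewrite invr_ge0.
apply: (@le_trans _ _ ((n%:R^-1 - n.+1%:R^-1) * (256 * t ^+ 2 * s) +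
   n.+1%:R^-1 * (40 * t ^+ 2 * s / n%:R))).
  apply: lerD; first by rewrite ler_wpM2l// subr_ge0 lef_pV2 ?posrE ?ltr0n// ler_nat.
  rewrite ler_wpM2l ?invr_ge0// (le_trans term23)//.
  rewrite -mulrDl ler_wpM2r ?invr_ge0// -mulrDl.
  have : t ^+ 2 * s' <= t ^+ 2 * (2 * s) by rewrite ler_wpM2l.
  lra.
have -> : n%:R^-1 - n.+1%:R^-1 = (n%:R * n.+1%:R)^-1 :> R.
  by rewrite -natr1; field; rewrite natr1 !gt_eqF// ?ltr0n//; lra.
have -> : (n%:R * n.+1%:R)^-1 * (256 * t ^+ 2 * s) + n.+1%:R^-1 * (40 * t ^+ 2 * s / n%:R)
   = t ^+ 2 * (296 * (s / (n%:R * n.+1%:R))).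
  by field; rewrite !gt_eqF//; lra.
rewrite [leRHS](_ : _ = t ^+ 2 * (600 * (s^-1 - s'^-1))); last by ring.
rewrite ler_wpM2l//.
have -> : s^-1 - s'^-1 = (s * s' * (s + s'))^-1.
  have D : s' ^+ 2 - s ^+ 2 = 1 by rewrite -nE -nE' -natr1; ring.
  have D' : (s' - s) * (s + s') = 1 by rewrite -D; ring.
  apply: (mulIf (x := s * s' * (s + s'))); first by rewrite !mulf_neq0 ?gt_eqF//; lra.
  rewrite mulVf; last by rewrite !mulf_neq0 ?gt_eqF//; lra.
  rewrite -D'; field; rewrite !gt_eqF//; lra.
have -> : s / (n%:R * n.+1%:R) = (s * s' ^+ 2)^-1.
  by rewrite nE nE'; field; rewrite !gt_eqF//; lra.
(* Since [s + s' <= 2 s']; the doubling turns 296 into 592, which is below the stated 600. *)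
have : (s * s' ^+ 2)^-1 <= 2 * (s * s' * (s + s'))^-1.
  rewrite -[leRHS]invf_div lef_pV2 ?posrE ?divr_gt0 ?mulr_gt0 ?exprn_gt0 ?addr_gt0//.
  have : s * s' * (s + s') <= s * s' * (2 * s').
    by rewrite ler_wpM2l ?mulr_ge0 ?(ltW s0) ?(ltW s'0)//; lra.
  rewrite expr2; lra.
have : 0 < (s * s' * (s + s'))^-1 by rewrite invr_gt0 !mulr_gt0// addr_gt0.
lra.
Qed.

End SeriesNearOne.

Section DirichletLNearOne.
Variables (R : realType) (x : nat -> R) (B : R).
Hypothesis xB : forall N, `|\sum_(1 <= n < N) x n| <= B.

Lemma nat_cpow_split (h : R[i]) (n : nat) : (0 < n)%N ->
  nat_cpow n (- (h + 1)) =
  (n%:R^-1)%:C - h * (ln n%:R / n%:R)%:C + cpow_rem h n.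
Proof.
move=> n0; rewrite /nat_cpow /cpow_rem.
have -> : - (h + 1) * (ln n%:R)%:C = - h * (ln n%:R)%:C + (- ln n%:R)%:C.
  by rewrite rmorphN; ring.
rewrite cexpD.
have -> : cexp (- ln n%:R)%:C = (n%:R^-1 : R)%:C.
  by rewrite /cexp /= cos0 sin0 mulr0 mulr1 expRN lnK// posrE ltr0n.
by rewrite rmorphM; ring.
Qed.

(** [1712 = 2 * (256 + 600)]: the last term and the telescoped differences, with the 2 of
    [abel_normc]. It doubles again to 3424 when the complex limit is taken. *)
Lemma cpow_rem_range (h : R[i]) (m N : nat) : normc h <= 4^-1 -> (m <= N)%N ->
  normc (\sum_(m.+1 <= n < N.+1) (x n)%:C * cpow_rem h n) <=
  1712 * B * normc h ^+ 2 * (Num.sqrt m.+1%:R)^-1.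
Proof.
move=> h4; have B0 := partial_sum_bound_ge0 xB.
rewrite leq_eqVlt => /predU1P[->|mN].
  rewrite big_geq// normc_zero.
  apply: mulr_ge0; last by rewrite invr_ge0 sqrtr_ge0.
  exact: mulr_ge0 (mulr_ge0 (ler0n _ _) B0) (sqr_ge0 _).
rewrite (le_trans (abel_normc xB _ _ _))//.
have t0 : 0 <= normc h ^+ 2 by rewrite sqr_ge0.
have lastb : normc (cpow_rem h N) <= 256 * normc h ^+ 2 * (Num.sqrt m.+1%:R)^-1.
  have N0 : (0 < N)%N by exact: leq_ltn_trans mN.
  have N0' : (0 : R) < N%:R by rewrite ltr0n.
  have m0' : (0 : R) < m.+1%:R by rewrite ltr0n.
  rewrite /cpow_rem normcM normc_real ger0_norm ?invr_ge0 ?ler0n//.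
  rewrite (@le_trans _ _ (N%:R^-1 * (256 * normc h ^+ 2 * Num.sqrt N%:R)))//.
    by rewrite ler_wpM2l ?invr_ge0 ?ler0n// normc_cexp_rem_ln.
  rewrite mulrCA; apply: ler_wpM2l; first exact: mulr_ge0 (ler0n _ _) t0.
  rewrite -[X in X^-1 * _](sqr_sqrtr (ltW N0')) expr2 invfM -mulrA.
  rewrite mulVf ?gt_eqF ?sqrtr_gt0// mulr1.
  by rewrite lef_pV2 ?posrE ?sqrtr_gt0// ler_wsqrtr// ler_nat.
have diffb : \sum_(m.+1 <= n < N) normc (cpow_rem h n - cpow_rem h n.+1) <=
    600 * normc h ^+ 2 * (Num.sqrt m.+1%:R)^-1.
  apply: (@le_trans _ _ (\sum_(m.+1 <= n < N) 600 * normc h ^+ 2 *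
      ((Num.sqrt n%:R)^-1 - (Num.sqrt n.+1%:R)^-1))).
    rewrite big_nat [leRHS]big_nat; apply: ler_sum => n /andP[mn nN].
    by rewrite cpow_rem_diff// (leq_trans _ mn).
  rewrite -mulr_sumr; apply: ler_wpM2l; first exact: mulr_ge0 (ler0n _ _) t0.
  under eq_bigr do rewrite -opprB.
  by rewrite sumrN telescope_sumr// opprB gerBl invr_ge0 sqrtr_ge0.
rewrite (@le_trans _ _ (2 * B * (256 * normc h ^+ 2 * (Num.sqrt m.+1%:R)^-1 +
  600 * normc h ^+ 2 * (Num.sqrt m.+1%:R)^-1)))//.
  by rewrite ler_wpM2l ?mulr_ge0 ?lerD.
by rewrite le_eqVlt; apply/orP; left; apply/eqP; ring.
Qed.

Lemma cvg_cpow_rem (h : R[i]) : normc h <= 4^-1 -> exists2 g : R[i],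
  ((fun N => \sum_(1 <= n < N.+1) (x n)%:C * cpow_rem h n) @ \oo
     --> (g : (R[i])^o))%classic &
  normc g <= 3424 * B * normc h ^+ 2.
Proof.
move=> h4; have [||g cg gb] := @cauchy_cvg_ratec R
  (fun N => \sum_(1 <= n < N.+1) (x n)%:C * cpow_rem h n)
  (fun m => 1712 * B * normc h ^+ 2 * (Num.sqrt m.+1%:R)^-1).
- rewrite -[X in (_ --> X)%classic](mulr0 (1712 * B * normc h ^+ 2)).
  by apply: cvgM; [exact: cvg_cst|exact: cvg_inv_sqrt].
- by move=> m N mN; rewrite sum_range_cat// cpow_rem_range.
exists g => //; have := gb 0%N; rewrite big_geq// subr0 sqrtr1 invr1; lra.
Qed.

Lemma cvg_real_complex (u : nat -> R) (l : R) : (u @ \oo --> l)%classic ->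
  ((fun n => (u n)%:C) @ \oo --> (l%:C : (R[i])^o))%classic.
Proof.
move=> ul; apply: (@cvg_normc _ _ _ (fun n => `|l - u n|)).
  rewrite -[X in (_ --> X)%classic](@normr0 _ R) -(subrr l).
  by apply: cvg_norm; apply: cvgB => //; exact: cvg_cst.
by move=> n; rewrite -rmorphB normc_real.
Qed.

Variables L1 Ll : R.
Hypothesis cL1 : ((fun N => \sum_(1 <= n < N.+1) x n * n%:R^-1) @ \oo --> L1)%classic.
Hypothesis cLl :
  ((fun N => \sum_(1 <= n < N.+1) x n * (ln n%:R / n%:R)) @ \oo --> Ll)%classic.

(** Each partial sum near 1 splits into three convergent ones, so the limit defining [dirichlet_L]
    is a genuine one for complex [h] of either sign of the real part, and the expansion needs no
    theory of analytic functions. *)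
Lemma dirichlet_L_near1 (h : R[i]) : normc h <= 4^-1 ->
  normc (dirichlet_L (fun n => (x n)%:C) (h + 1) - (L1%:C - h * Ll%:C)) <=
  3424 * B * normc h ^+ 2.
Proof.
move=> /cvg_cpow_rem[g cg gb]; rewrite (_ : dirichlet_L _ _ = L1%:C - h * Ll%:C + g).
  by rewrite addrC addKr.
apply: (@cvg_lim (R[i])^o); first exact: norm_hausdorff.
have -> : (fun N => \sum_(1 <= n < N.+1) (x n)%:C * nat_cpow n (- (h + 1)) : (R[i])^o) =
  (fun N => (\sum_(1 <= n < N.+1) x n * n%:R^-1)%:C +
   - h * (\sum_(1 <= n < N.+1) x n * (ln n%:R / n%:R))%:C +
   \sum_(1 <= n < N.+1) (x n)%:C * cpow_rem h n).
  apply/funext => N; rewrite !rmorph_sum mulr_sumr -!big_split /=.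
  rewrite !big_nat; apply: eq_bigr => n /andP[n0 _].
  by rewrite nat_cpow_split// !rmorphM; ring.
have H1 := @cvgcZ _ (- h) _ _ (cvg_real_complex cLl).
have H2 := cvgcD (cvg_real_complex cL1) H1.
have H3 := cvgcD H2 cg.
by rewrite -mulNr.
Qed.

Lemma dirichlet_L1E : dirichlet_L (fun n => (x n)%:C) 1 = L1%:C.
Proof.
have := @dirichlet_L_near1 0; rewrite normc_zero add0r mul0r subr0 expr0n mulr0.
rewrite invr_ge0 ler0n => /(_ isT) H.
by apply/eqP; rewrite -subr_eq0; apply/eqP/eq0_normc/eqP; rewrite eq_le H normc_ge0.
Qed.

Lemma dirichlet_L'1E : dirichlet_L' (fun n => (x n)%:C) 1 = (- Ll)%:C.
Proof.
apply: (@cvg_lim (R[i])^o); first exact: norm_hausdorff.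
have K0 : 0 <= 3424 * B := mulr_ge0 (ler0n _ _) (partial_sum_bound_ge0 xB).
have := dirichlet_L_near1; move: (3424 * B) K0 => K K0 near1.
apply/(@cvgrPdist_lt R[i] (R[i])^o) => -[a b]; rewrite ltcE /= => /andP[/eqP -> a0].
(* [1/4] is the range of validity of [near1]; the denominator [K + 1] instead of [K] guards against
   [K = 0]. *)
pose d : R := Num.min 4^-1 (a / (K + 1)).
have B1 : 0 < K + 1 by lra.
have d0 : 0 < d by rewrite /d lt_min invr_gt0 ltr0n divr_gt0.
exists (d%:C); first by rewrite /= ltcR.
move=> h hd0 h0.
have hd : normc h < d.
  have : `|0 - h| < d%:C := hd0.
  move=> hd; rewrite -(ltcR (normc h)); apply: le_lt_trans hd.
  by rewrite sub0r normrN normr_normcE.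
rewrite normr_normcE ltcR /GRing.scale /=.
have n0 : 0 < normc h.
  by rewrite lt_neqAle normc_ge0 andbT eq_sym; apply: contra h0 => /eqP/eq0_normc ->.
have h4 : normc h <= 4^-1 by rewrite (le_trans (ltW hd))// /d ge_min lexx.
have := near1 h h4; rewrite dirichlet_L1E.
set D := dirichlet_L _ _ => HD.
have -> : (- Ll)%:C - h^-1 * (D - L1%:C) = - (h^-1 * (D - (L1%:C - h * Ll%:C))).
  by rewrite rmorphN; field.
rewrite normcN normcM normcV ltr_pdivrMl// (le_lt_trans HD)//.
rewrite expr2 mulrCA ltr_pM2l//.
have hd2 : normc h < a / (K + 1).
  by rewrite (lt_le_trans hd)// /d ge_min lexx orbT.
rewrite ltr_pdivlMr// mulrC in hd2; lra.
Qed.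

End DirichletLNearOne.

(** * The divisor sum of a character *)

Section HarmonicNumbers.
Variable R : realType.

(** [expR x <= 1 / (1 - x)] at [x = 1/6] gives [e <= (6/5)^6 < 3]; with [1/5] instead the bound
    would exceed 3. This is what makes [ln q >= 1] for [q >= 3]. *)
Lemma expR1_le3 : expR 1 <= 3 :> R.
Proof.
have -> : 1 = 6%:R * 6^-1 :> R by field.
rewrite expRM_natl; have h : expR (6^-1) <= 6 / 5 :> R.
  by have := @expRB1_le R (6^-1); lra.
apply: (@le_trans _ _ ((6 / 5) ^+ 6)); last by lra.
by rewrite lerXn2r// nnegrE ?expR_ge0//; lra.
Qed.

Definition harmonic_number (m : nat) : R := \sum_(1 <= k < m.+1) k%:R^-1.

Lemma harmonic_numberS m : harmonic_number m.+1 = harmonic_number m + m.+1%:R^-1.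
Proof. by rewrite /harmonic_number big_nat_recr. Qed.

Lemma le_harmonic_number m n : (m <= n)%N -> harmonic_number m <= harmonic_number n.
Proof.
move=> /subnKC <-; elim: (n - m)%N => [|k IH]; first by rewrite addn0.
by rewrite addnS harmonic_numberS (le_trans IH)// lerDl invr_ge0.
Qed.

Lemma harmonic_number_ge0 m : 0 <= harmonic_number m.
Proof. by apply: sumr_ge0 => k _; rewrite invr_ge0. Qed.

Lemma ln_succ_sub_ge (n : nat) : (0 < n)%N ->
  n.+1%:R^-1 <= ln (n.+1%:R : R) - ln n%:R.
Proof.
move=> n0; have n0' : (0 : R) < n%:R by rewrite ltr0n.
have n1' : (0 : R) < n.+1%:R by rewrite ltr0n.
have H : ln (n%:R / n.+1%:R) <= - n.+1%:R^-1 :> R.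
  have -> : n%:R / n.+1%:R = 1 + - n.+1%:R^-1 :> R.
    by rewrite -natr1; field; rewrite natr1 gt_eqF.
  by rewrite le_ln1Dx// ltrN2 invf_lt1// ltr1n.
by move: H; rewrite ln_div ?posrE//; move: n.+1%:R^-1 (ln _) (ln _) => a b c; lra.
Qed.

Lemma harmonic_number_le m : (0 < m)%N -> harmonic_number m <= 1 + ln m%:R.
Proof.
elim: m => // -[_ _|m IH _]; first by rewrite /harmonic_number big_nat1 ln1 invr1 addr0.
rewrite harmonic_numberS; have := IH isT; have := @ln_succ_sub_ge m.+1 isT.
by move: m.+2%:R^-1 (ln m.+2%:R) => a b; lra.
Qed.

Lemma euler_constant : exists2 gam : R, `|gam| <= 2 &
  forall m, (0 < m)%N -> `|harmonic_number m - ln m%:R - gam| <= m%:R^-1.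
Proof.
pose u n := harmonic_number n.+1 - ln n.+1%:R.
have [||g _ gu] := @cauchy_cvg_rate R u (fun n => n.+1%:R^-1).
- exact: cvg_harmonic.
- move=> m n mn.
  (* [u] decreases while [u n - 1/(n+1)] increases, so [u m - u n] is caught between 0 and
     [1/(m+1) - 1/(n+1)]. *)
  have H : u n <= u m /\ u m - m.+1%:R^-1 <= u n - n.+1%:R^-1.
    move: mn => /subnKC <-; elim: (n - m)%N => [|k [IH1 IH2]]; first by rewrite addn0.
    have := @ln_succ_sub_ge (m + k).+1 isT.
    have := @ln_succ_sub R (m + k).+1 isT => /andP[_].
    move: IH1 IH2; rewrite /u !addnS !(harmonic_numberS (m + k).+1).
    move: (m + k).+2%:R^-1 (m + k).+1%:R^-1 m.+1%:R^-1 => a b c.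
    move: (ln (m + k).+2%:R) (ln (m + k).+1%:R) (ln m.+1%:R) => e f g.
    by move: (harmonic_number (m + k).+1) (harmonic_number m.+1) => h i; split; lra.
  have : 0 <= (n.+1%:R : R)^-1 by rewrite invr_ge0.
  by move: n.+1%:R^-1 m.+1%:R^-1 H => a b [] *; rewrite ler_norml; lra.
exists g => [|[//|m] _]; last by rewrite distrC; exact: gu.
have := gu 0%N; rewrite /u /harmonic_number big_nat1 ln1 invr1 subr0 !ler_norml; lra.
Qed.

End HarmonicNumbers.

Section DivisorSums.

Lemma sum_dvdn_reindex (V : nmodType) (F : nat -> V) (d N : nat) : (0 < d)%N ->
  \sum_(1 <= n < N.+1 | (d %| n)%N) F n = \sum_(1 <= k < (N %/ d).+1) F (d * k)%N.
Proof.
move=> d0; elim: N => [|N IH]; first by rewrite div0n !big_geq.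
rewrite big_mkcond big_nat_recr//= -big_mkcond /= IH divnS//.
have [/dvdnP[k ek]|ndN] := boolP (d %| N.+1)%N; last by rewrite add0n addr0.
rewrite add1n [in RHS]big_nat_recr//=; congr (_ + F _).
have : ((d %| N.+1) + N %/ d = k)%N by rewrite -divnS// ek mulnK.
by rewrite ek dvdn_mull// add1n mulnC => ->.
Qed.

Variables (R : realType) (x : nat -> R).

Definition lam (n : nat) : R := \sum_(1 <= d < n.+1 | (d %| n)%N) x d.

Lemma lam_widen n N : (0 < n)%N -> (n <= N)%N ->
  lam n = \sum_(1 <= d < N.+1 | (d %| n)%N) x d.
Proof.
move=> n0 nN; rewrite /lam [RHS](@big_cat_nat _ _ _ n.+1)//=.
rewrite [X in _ = _ + X]big_nat_cond [X in _ = _ + X]big1 ?addr0// => d.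
by move=> /andP[/andP[nd _] /dvdn_leq]; rewrite n0 leqNgt nd => /(_ isT).
Qed.

(** Write [n = d * k] and sum over the cofactor [k] first. *)
Lemma sum_lam_div N : \sum_(1 <= n < N.+1) lam n / n%:R =
  \sum_(1 <= d < N.+1) x d * (d%:R^-1 * harmonic_number R (N %/ d)).
Proof.
transitivity (\sum_(1 <= n < N.+1) \sum_(1 <= d < N.+1)
   if (d %| n)%N then x d / n%:R else 0).
  rewrite big_nat [RHS]big_nat; apply: eq_bigr => n /andP[n0 nN].
  by rewrite (lam_widen n0 nN) mulr_suml big_mkcond.
rewrite exchange_big /= big_nat [RHS]big_nat; apply: eq_bigr => d /andP[d0 dN].
rewrite -big_mkcond sum_dvdn_reindex// /harmonic_number !mulr_sumr.
by apply: eq_bigr => k _; rewrite natrM invfM.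
Qed.

End DivisorSums.

(** * Asymptotics of the logarithmic mean of [lam] *)

Section DivisorSumAsymptotics.
Variables (R : realType) (x : nat -> R) (q : nat).
Hypothesis xq : forall N, `|\sum_(1 <= n < N) x n| <= q%:R.
Hypothesis x1 : forall n, `|x n| <= 1.
Hypothesis q3 : (3 <= q)%N.
Variables L1 Ll gam : R.
Hypothesis L1b : forall m, `|L1 - \sum_(1 <= n < m.+1) x n * n%:R^-1| <=
  2 * q%:R * ((2 + ln m.+1%:R) / m.+1%:R).
Hypothesis Llb : forall m, `|Ll - \sum_(1 <= n < m.+1) x n * (ln n%:R / n%:R)| <=
  2 * q%:R * ((2 + ln m.+1%:R) / m.+1%:R).
Hypothesis gam2 : `|gam| <= 2.
Hypothesis gamb : forall m, (0 < m)%N ->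
  `|harmonic_number R m - ln m%:R - gam| <= m%:R^-1.

(** With [m] the integer quotient, replacing [ln (N/d)] by [ln m] costs at most [1/m] and Euler's
    constant another [1/m]; and [1/m <= 2 d / N] because [N < (m + 1) d <= 2 m d]. *)
Lemma harmonic_number_divn (N d : nat) : (0 < d)%N -> (d <= N)%N ->
  `|harmonic_number R (N %/ d) - (ln N%:R - ln d%:R) - gam| <= 4 * d%:R / N%:R.
Proof.
move=> d0 dN; set m := (N %/ d)%N.
have m0 : (0 < m)%N by rewrite divn_gt0.
have m0' : (0 : R) < m%:R by rewrite ltr0n.
have d0' : (0 : R) < d%:R by rewrite ltr0n.
have N0' : (0 : R) < N%:R by rewrite ltr0n (leq_trans d0).
have h1 : ln m%:R <= ln N%:R - ln d%:R :> R.
  rewrite -ln_div ?posrE// ler_ln ?posrE ?divr_gt0// ler_pdivlMr//.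
  by rewrite -natrM ler_nat leq_trunc_div.
have h2 : ln N%:R - ln d%:R <= ln m.+1%:R :> R.
  rewrite -ln_div ?posrE// ler_ln ?posrE ?divr_gt0// ler_pdivrMr//.
  by rewrite -natrM ler_nat ltnW// ltn_ceil.
have := @ln_succ_sub R m m0 => /andP[_ h3].
have h4 : m%:R^-1 <= 2 * d%:R / N%:R :> R.
  rewrite -[leRHS]invf_div lef_pV2 ?posrE ?divr_gt0 ?mulr_gt0// ler_pdivrMr ?mulr_gt0//.
  rewrite -!natrM ler_nat mulnA (leq_trans (ltnW (ltn_ceil N d0)))// leq_mul2r.
  by apply/orP; right; rewrite /m; lia.
have := gamb m0; rewrite !ler_norml; lra.
Qed.

(** Divisors are split at [D = q^2]. Below, the harmonic asymptotics cost [4/N] for each [d], in all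
    [4 D / N <= 4 / q], which is where [N >= q^3] enters. Above, the weights [H(N/d) / d] decrease
    in [d], so the bound [q] on character sums gives [O(q * ln N / D) = O(ln N / q)]. Completing the
    two series cut at [D] costs [O(ln q / q)] each. *)
Lemma sum_lam_asymptotics (N : nat) : (q ^ 3 <= N)%N ->
  `|\sum_(1 <= n < N.+1) lam x n / n%:R - (L1 * (ln N%:R + gam) - Ll)| <=
  50 * ln q%:R * ln N%:R / q%:R.
Proof.
move=> qN; pose D := (q ^ 2)%N.
have q0 : (0 < q)%N by rewrite (leq_trans _ q3).
have q0' : (0 : R) < q%:R by rewrite ltr0n.
have D0 : (0 < D)%N by rewrite expn_gt0 q0.
have D0' : (0 : R) < D%:R by rewrite ltr0n.
have DE : D%:R = q%:R ^+ 2 :> R by rewrite natrX.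
have DN : (D <= N)%N by rewrite (leq_trans _ qN)// leq_exp2l// (leq_trans _ q3).
have N0 : (0 < N)%N by exact: leq_trans DN.
have N0' : (0 : R) < N%:R by rewrite ltr0n.
have l1 : 1 <= ln (q%:R : R).
  have h3 : ln (3%:R : R) <= ln q%:R by rewrite ler_ln ?posrE ?ltr0n// ler_nat.
  rewrite (le_trans _ h3)// -[leLHS]expRK ler_ln ?posrE ?expR_gt0//.
  exact: expR1_le3.
have lN : ln (q%:R : R) <= ln N%:R.
  rewrite ler_ln ?posrE// ler_nat (leq_trans _ qN)//.
  by rewrite -[leqLHS]expn1 leq_exp2l// (leq_trans _ q3).
rewrite sum_lam_div (@big_cat_nat _ _ _ D.+1)//=.
set S1 := \sum_(1 <= _ < _) _; set S2 := \sum_(D.+1 <= _ < _) _.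
pose T1 := \sum_(1 <= n < D.+1) x n * n%:R^-1.
pose T2 := \sum_(1 <= n < D.+1) x n * (ln n%:R / n%:R).
have hS1 : `|S1 - (T1 * (ln N%:R + gam) - T2)| <= 4 / q%:R.
  have -> : S1 - (T1 * (ln N%:R + gam) - T2) = \sum_(1 <= d < D.+1)
      x d * (d%:R^-1 * (harmonic_number R (N %/ d) - (ln N%:R - ln d%:R) - gam)).
    rewrite /S1 /T1 /T2 mulr_suml -sumrB -sumrB.
    by apply: eq_bigr => d _; ring.
  rewrite (le_trans (ler_norm_sum _ _ _))//.
  apply: (@le_trans _ _ (\sum_(1 <= d < D.+1) 4 / N%:R)).
    rewrite big_nat [leRHS]big_nat; apply: ler_sum => d /andP[d0 dD].
    have d0' : (0 : R) < d%:R by rewrite ltr0n.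
    rewrite normrM (le_trans (ler_piMl _ (x1 d)))// normrM ger0_norm ?invr_ge0 ?ler0n//.
    rewrite ler_pdivrMl// mulrCA mulrA.
    by apply: harmonic_number_divn => //; rewrite (leq_trans _ DN).
  rewrite sumr_const_nat subn1 -[leLHS]mulr_natr mulrAC ler_pdivrMr//.
  rewrite -mulrA ler_wpM2l// mulrC ler_pdivlMr// DE -natrX -natrM ler_nat.
  by rewrite -expnSr.
have hS2 : `|S2| <= 4 * ln N%:R / q%:R.
  apply: le_trans (abel_monotone xq (m := D.+1)
    (a := fun d => d%:R^-1 * harmonic_number R (N %/ d)) _ _ _) _ => //.
    move=> d Dd; have d0 : (0 < d)%N by exact: leq_trans Dd.
    rewrite mulr_ge0 ?harmonic_number_ge0 ?invr_ge0//= ler_pM ?harmonic_number_ge0 ?invr_ge0//.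
      by rewrite lef_pV2 ?posrE ?ltr0n// ler_nat.
    by rewrite le_harmonic_number// leq_div2l.
  have h1 : harmonic_number R (N %/ D.+1) <= 2 * ln N%:R.
    rewrite (le_trans (le_harmonic_number R (leq_div _ _)))//.
    by rewrite (le_trans (harmonic_number_le R N0))//; lra.
  have h2 : D.+1%:R^-1 <= (q%:R ^+ 2)^-1 :> R.
    by rewrite -DE lef_pV2 ?posrE ?ltr0n// ler_nat.
  apply: (@le_trans _ _ (2 * q%:R * ((q%:R ^+ 2)^-1 * (2 * ln N%:R)))).
    apply: ler_wpM2l; first by rewrite mulr_ge0.
    by rewrite ler_pM ?invr_ge0 ?harmonic_number_ge0.
  by rewrite le_eqVlt; apply/orP; left; apply/eqP; field; rewrite gt_eqF.
have rate : 2 * q%:R * ((2 + ln D.+1%:R) / D.+1%:R) <= 10 * ln q%:R / q%:R :> R.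
  have h1 : ln D.+1%:R <= 3 * ln q%:R :> R.
    rewrite [leRHS](_ : _ = ln (q%:R ^+ 3)); last by rewrite lnXn// mulr_natl.
    rewrite ler_ln ?posrE ?exprn_gt0 ?ltr0n// -natrX ler_nat /D.
    rewrite -addn1 (expnS q 2); have : (1 <= q ^ 2)%N by rewrite expn_gt0 q0.
    by move: (q ^ 2)%N => y; nia.
  apply: (@le_trans _ _ (2 * q%:R * ((5 * ln q%:R) / (q%:R ^+ 2)))).
    apply: ler_wpM2l; first by rewrite mulr_ge0.
    apply: ler_pM; rewrite ?invr_ge0//.
    - have : 0 <= ln (D.+1%:R : R) by rewrite ln_ge0// ler1n.
      lra.
    - lra.
    - by rewrite -DE lef_pV2 ?posrE ?ltr0n// ler_nat.
  by rewrite le_eqVlt; apply/orP; left; apply/eqP; field; rewrite gt_eqF.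
have hT1 : `|T1 - L1| <= 10 * ln q%:R / q%:R by rewrite distrC (le_trans (L1b _)).
have hT2 : `|T2 - Ll| <= 10 * ln q%:R / q%:R by rewrite distrC (le_trans (Llb _)).
have -> : S1 + S2 - (L1 * (ln N%:R + gam) - Ll) =
  (S1 - (T1 * (ln N%:R + gam) - T2)) + S2 + (T1 - L1) * (ln N%:R + gam) - (T2 - Ll).
  by ring.
have hg : `|ln N%:R + gam| <= 3 * ln N%:R.
  by move: gam2; rewrite !ler_norml; lra.
have hT1g : `|(T1 - L1) * (ln N%:R + gam)| <= (10 * ln q%:R / q%:R) * (3 * ln N%:R).
  by rewrite normrM ler_pM.
set E1 := S1 - _ in hS1 *; set E2 := T2 - Ll in hT2 *.
set E3 := (T1 - L1) * _ in hT1g *.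
have -> : 50 * ln q%:R * ln N%:R / q%:R = q%:R^-1 * (50 * (ln q%:R * ln N%:R)) :> R by ring.
have e1 : `|E1 + S2 + E3 - E2| <= q%:R^-1 *
   (4 + 4 * ln N%:R + 30 * (ln q%:R * ln N%:R) + 10 * ln q%:R).
  have -> : q%:R^-1 * (4 + 4 * ln N%:R + 30 * (ln q%:R * ln N%:R) + 10 * ln q%:R) =
    4 / q%:R + 4 * ln N%:R / q%:R + 10 * ln q%:R / q%:R * (3 * ln N%:R) +
    10 * ln q%:R / q%:R :> R by ring.
  rewrite (le_trans (ler_normB _ _))// lerD//.
  rewrite (le_trans (ler_normD _ _))// lerD//.
  by rewrite (le_trans (ler_normD _ _))// lerD.
apply: (le_trans e1); rewrite ler_pM2l ?invr_gt0//.
move: (ln q%:R) (ln N%:R) l1 lN => a b a1 ab.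
nra.
Qed.

End DivisorSumAsymptotics.

(** * Multiplicativity and positivity of [lam] *)

Section DivisorSumMultiplicativity.
Variables (R : realType) (x : nat -> R).
Hypothesis xM : forall m n, x (m * n)%N = x m * x n.
Hypothesis x1 : x 1%N = 1.
Hypothesis x01 : forall n, [\/ x n = 0, x n = 1 | x n = -1].

Lemma lam1 : lam x 1 = 1.
Proof. by rewrite /lam big_mkcond big_nat1 dvdnn. Qed.

Let lam_free p n := \sum_(1 <= d < n.+1 | (d %| n)%N && ~~ (p %| d)%N) x d.

(** The divisors of [p * n] that [p] divides are [p * d] with [d] dividing [n]; the others are the
    divisors of [n] prime to [p]. *)
Lemma lam_mul_prime p n : prime p -> (0 < n)%N ->
  lam x (p * n) = x p * lam x n + lam_free p n.
Proof.
move=> pp n0; have p0 := prime_gt0 pp.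
rewrite /lam (bigID (fun d => (p %| d)%N)) /=; congr (_ + _).
  under eq_bigl do rewrite andbC.
  rewrite big_mkcondr /= sum_dvdn_reindex// mulKn// mulr_sumr [RHS]big_mkcond.
  apply: eq_bigr => k _; rewrite dvdn_pmul2l// xM.
  by case: ifP.
rewrite (@big_cat_nat _ _ _ n.+1)//=; last by rewrite ltnS leq_pmull.
rewrite [X in _ + X]big_nat_cond [X in _ + X]big1 ?addr0.
  apply: eq_bigl => d; apply: andb_id2r => npd.
  by rewrite Gauss_dvdr// coprime_sym prime_coprime.
move=> d /andP[/andP[nd _] /andP[dpn npd]]; move: dpn.
rewrite Gauss_dvdr 1?coprime_sym ?prime_coprime//.
by move=> /dvdn_leq; rewrite n0 leqNgt nd => /(_ isT).
Qed.

Lemma lam_free_mul p n : prime p -> (0 < n)%N -> lam_free p (p * n) = lam_free p n.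
Proof.
move=> pp n0; have p0 := prime_gt0 pp.
rewrite /lam_free (@big_cat_nat _ _ _ n.+1)//=; last by rewrite ltnS leq_pmull.
rewrite [X in _ + X]big_nat_cond [X in _ + X]big1 ?addr0.
  apply: eq_bigl => d; apply: andb_id2r => npd.
  by rewrite Gauss_dvdr// coprime_sym prime_coprime.
move=> d /andP[/andP[nd _] /andP[dpn npd]]; move: dpn.
rewrite Gauss_dvdr 1?coprime_sym ?prime_coprime//.
by move=> /dvdn_leq; rewrite n0 leqNgt nd => /(_ isT).
Qed.

(** When [p] does not divide [n], the free part of [p^j * n] is always [lam x n], so [lam_mul_prime]
    is Horner's recursion for the geometric sum in [x p]. *)
Lemma lam_pow p n k : prime p -> ~~ (p %| n)%N ->
  lam x (n * p ^ k) = lam x n * \sum_(i < k.+1) x p ^+ i.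
Proof.
move=> pp pn; have p0 := prime_gt0 pp.
have n0 : (0 < n)%N by case: n pn => //; rewrite dvdn0.
have free j : lam_free p (p ^ j * n) = lam x n.
  elim: j => [|j IH]; last by rewrite expnS -mulnA lam_free_mul// muln_gt0 expn_gt0 p0.
  rewrite mul1n /lam_free /lam; apply: eq_bigl => d; apply: andb_idr => dn.
  by apply: contra pn => /dvdn_trans; apply.
elim: k => [|k IH]; first by rewrite muln1 big_ord1 expr0 mulr1.
rewrite mulnC expnS -mulnA lam_mul_prime ?muln_gt0 ?expn_gt0 ?p0// free mulnC IH.
rewrite [in RHS]big_ord_recl expr0 mulrDr mulr1 addrC; congr (_ + _).
by rewrite mulrCA mulr_sumr; congr (_ * _); apply: eq_bigr => i _; rewrite -exprS.
Qed.

Lemma lam_ppow p k : prime p -> lam x (p ^ k) = \sum_(i < k.+1) x p ^+ i.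
Proof.
by move=> pp; rewrite -[(p ^ k)%N]mul1n lam_pow// ?lam1 ?mul1r// dvdn1 gtn_eqF ?prime_gt1.
Qed.

Lemma lamM p n k : prime p -> ~~ (p %| n)%N ->
  lam x (n * p ^ k) = lam x n * lam x (p ^ k).
Proof. by move=> pp pn; rewrite lam_pow// lam_ppow. Qed.

Lemma lam_prime p : prime p -> lam x p = 1 + x p.
Proof.
by move=> pp; rewrite -{1}(expn1 p) lam_ppow// big_ord_recl big_ord1 expr0 expr1.
Qed.

Lemma geometric_sign_ge0 (t : R) k : [\/ t = 0, t = 1 | t = -1] ->
  0 <= \sum_(i < k) t ^+ i.
Proof.
move=> [->|->|->].
- by apply: sumr_ge0 => i _; rewrite exprn_ge0.
- by apply: sumr_ge0 => i _; rewrite exprn_ge0.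
suff -> : \sum_(i < k) (-1) ^+ i = (odd k)%:R :> R by rewrite ler0n.
elim: k => [|k IH]; first by rewrite big_ord0.
rewrite big_ord_recr /= IH -signr_odd; case: (odd k) => /=.
  by rewrite expr1 subrr.
by rewrite expr0 add0r.
Qed.

Lemma lam_ge0 n : (0 < n)%N -> 0 <= lam x n.
Proof.
elim/ltn_ind: n => n IH n0.
have [n1|n1] := leqP n 1.
  have -> : n = 1%N by apply/eqP; rewrite eqn_leq n1.
  by rewrite lam1.
have pp := pdiv_prime n1; set p := pdiv n in pp.
have [m cm en] := pfactor_coprime pp n0.
have pm : ~~ (p %| m)%N by rewrite -prime_coprime.
have m0 : (0 < m)%N by case: m pm {cm en} => //; rewrite dvdn0.
rewrite en lam_pow// mulr_ge0 ?geometric_sign_ge0// IH// en ltn_Pmulr//.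
rewrite -[ltnLHS](expn0 p) ltn_exp2l ?prime_gt1//.
by rewrite logn_gt0 mem_primes pp n0 pdiv_dvd.
Qed.

(** This substitutes for multiplicativity when [p] may divide [m]. Only the local sums at [p]
    matter: for [x p = 0] both are 1, for [x p = 1] the sum grows with the exponent, which uses up
    the factor 2, and for [x p = -1] the left side vanishes. *)
Lemma lam_prime_mul_le p m : prime p -> (0 < m)%N ->
  lam x p * lam x m <= 2 * lam x (p * m).
Proof.
move=> pp m0; have [n cn em] := pfactor_coprime pp m0.
have pn : ~~ (p %| n)%N by rewrite -prime_coprime.
have n0 : (0 < n)%N by case: n pn {cn em} => //; rewrite dvdn0.
move: em; move: (logn p m) => k ->; rewrite mulnCA -expnS lam_prime// !lam_pow//.
have := lam_ge0 n0; move: (lam x n) => a a0.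
rewrite mulrCA [leRHS]mulrCA ler_wpM2l//.
have h0 := geometric_sign_ge0 k.+1 (x01 p).
have h1 := geometric_sign_ge0 k.+2 (x01 p).
case: (x01 p) h0 h1 => -> h0 h1.
- rewrite addr0 mul1r big_ord_recl expr0 big1 ?addr0; last by move=> i _; rewrite exprS mul0r.
  by rewrite big_ord_recl expr0 big1 ?addr0 ?mulr1 ?ler1n// => i _; rewrite exprS mul0r.
- rewrite ler_wpM2l// [leRHS]big_ord_recr/= lerDl exprn_ge0//.
- by rewrite subrr mul0r mulr_ge0.
Qed.

End DivisorSumMultiplicativity.

(** * Euler products over smooth numbers *)

Section EulerProduct.
Variables (R : realType).

Lemma ler_sum_subset (T : eqType) (f : T -> R) (P : pred T) (s t : seq T) :
  uniq s -> uniq t -> {in s, forall n, n \in t /\ P n} -> {in t, forall n, 0 <= f n} ->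
  \sum_(n <- s) f n <= \sum_(n <- t | P n) f n.
Proof.
move=> us ut st f0.
rewrite (perm_big [seq n <- t | (n \in s)]) /=; last first.
  apply: uniq_perm => //; first exact: filter_uniq.
  by move=> n; rewrite mem_filter; case: (boolP (n \in s)) => //= /st[-> _].
rewrite big_filter big_seq_cond [leRHS]big_seq_cond.
rewrite [leLHS]big_mkcond [leRHS]big_mkcond; apply: ler_sum => n _.
have [nt|] /= := boolP (n \in t); last by [].
have [/st[_ ->]//|_] := boolP (n \in s).
by case: ifP => // _; exact: f0.
Qed.

Definition smooth (z n : nat) := all (fun p => (p < z)%N) (primes n).

Lemma smoothP z n : (0 < n)%N ->
  reflect (forall p, prime p -> (p %| n)%N -> (p < z)%N) (smooth z n).
Proof.
move=> n0; apply: (iffP allP) => H p.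
  by move=> pp pn; apply: H; rewrite mem_primes pp n0.
by rewrite mem_primes => /and3P[pp _ pn]; exact: H.
Qed.

Variable K : nat.

(** Cutting every exponent below [K] keeps the list finite, so a product of truncated local sums
    expands into a sum over it exactly, without convergence questions. *)
Fixpoint smooth_numbers (z : nat) : seq nat :=
  if z is z'.+1 then
    if prime z' then [seq (n * z' ^ k)%N | n <- smooth_numbers z', k <- iota 0 K]
    else smooth_numbers z'
  else [:: 1%N].

Lemma smooth_numbers_smooth z n : n \in smooth_numbers z -> (0 < n)%N /\ smooth z n.
Proof.
elim: z n => [|z IH] n /=; first by rewrite inE => /eqP ->.
have widen m : (0 < m)%N /\ smooth z m -> (0 < m)%N /\ smooth z.+1 m.
  move=> [m0 /(smoothP _ m0) H]; split => //; apply/smoothP => // p pp /(H _ pp).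
  by move/ltnW.
case: ifP => [pz /allpairsP[[m k] /= [/IH[m0 /(smoothP _ m0) H] _ ->]]|_ /IH/widen//].
have z0 := prime_gt0 pz.
split; first by rewrite muln_gt0 m0 expn_gt0 z0.
apply/smoothP; first by rewrite muln_gt0 m0 expn_gt0 z0.
move=> p pp; rewrite Euclid_dvdM// => /orP[/(H _ pp)/ltnW//|].
by rewrite Euclid_dvdX// => /andP[/dvdn_leq-/(_ z0)].
Qed.

Lemma smooth_numbers_ndvd z n : prime z -> n \in smooth_numbers z -> ~~ (z %| n)%N.
Proof.
move=> pz /smooth_numbers_smooth[n0 /(smoothP _ n0) H].
by apply/negP => /(H _ pz); rewrite ltnn.
Qed.

Lemma smooth_numbers_uniq z : uniq (smooth_numbers z).
Proof.
elim: z => //= z IH; case: ifP => // pz.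
apply: allpairs_uniq => //; first exact: iota_uniq.
have lk m k : m \in smooth_numbers z -> logn z (m * z ^ k) = k.
  move=> mz; have [m0 _] := smooth_numbers_smooth mz.
  have zk : (0 < z ^ k)%N by rewrite expn_gt0 prime_gt0.
  rewrite (lognM z m0 zk) pfactorK// logn_coprime//.
  by rewrite prime_coprime// smooth_numbers_ndvd.
move=> [m k] [m' k'] /allpairsP[[a b] /= [am _ [-> ->]]] /allpairsP[[c d] /= [cm _ [-> ->]]] e.
have bd : b = d by rewrite -(lk a b)// e lk.
move: e; rewrite bd => /eqP; rewrite eqn_pmul2r ?expn_gt0 ?prime_gt0//.
by move/eqP => ->.
Qed.

Lemma mem_smooth_numbers z n : (0 < n)%N -> smooth z n ->
  (forall p, prime p -> (logn p n < K)%N) -> n \in smooth_numbers z.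
Proof.
elim: z n => [|z IH] n n0 /(smoothP _ n0) sn ln /=.
  rewrite inE; case: (ltngtP n 1) => //; first by rewrite ltnS leqNgt n0.
  by move=> n1; have := sn _ (pdiv_prime n1) (pdiv_dvd n).
case: ifP => pz; last first.
  apply: IH => //; apply/smoothP => // p pp pn.
  have := sn _ pp pn; rewrite ltnS leq_eqVlt => /predU1P[pz'|//].
  by rewrite -pz' pp in pz.
have [m cm en] := pfactor_coprime pz n0.
have zm : ~~ (z %| m)%N by rewrite -prime_coprime.
have m0 : (0 < m)%N by case: m zm {cm en} => //; rewrite dvdn0.
have mn : (m %| n)%N by rewrite en dvdn_mulr.
apply/allpairsP; exists (m, logn z n); split => //=; last by rewrite mem_iota ln.
apply: IH => //.
  apply/smoothP => // p pp pm.
  have := sn _ pp (dvdn_trans pm mn); rewrite ltnS leq_eqVlt => /predU1P[pz'|//].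
  by rewrite -pz' pm in zm.
by move=> p pp; rewrite (leq_ltn_trans _ (ln p pp))// dvdn_leq_log.
Qed.

Variable f : nat -> R.
Hypothesis f1 : f 1%N = 1.
Hypothesis fM : forall p n k, prime p -> (0 < n)%N -> ~~ (p %| n)%N ->
  f (n * p ^ k)%N = f n * f (p ^ k)%N.

Lemma sum_smooth_numbers z : \sum_(n <- smooth_numbers z) f n =
  \prod_(p < z | prime p) \sum_(k < K) f (p ^ k)%N.
Proof.
elim: z => [|z IH] /=; first by rewrite big_seq1 big_ord0.
rewrite [RHS]big_mkcond [RHS]big_ord_recr /= -big_mkcond /= -IH.
case: ifP => pz; last by rewrite mulr1.
rewrite big_allpairs_dep /= mulr_suml big_seq [RHS]big_seq.
apply: eq_bigr => n nz.
rewrite -(big_mkord xpredT (fun k => f (z ^ k)%N)) /index_iota subn0 mulr_sumr.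
apply: eq_bigr => k _; rewrite fM//; first by case: (smooth_numbers_smooth nz).
exact: smooth_numbers_ndvd.
Qed.

End EulerProduct.

Section EulerProductBounds.
Variables (R : realType) (f : nat -> R).
Hypothesis f1 : f 1%N = 1.
Hypothesis fM : forall p n k, prime p -> (0 < n)%N -> ~~ (p %| n)%N ->
  f (n * p ^ k)%N = f n * f (p ^ k)%N.
Hypothesis f0 : forall n, (0 < n)%N -> 0 <= f n.
Variable E : nat -> R.

Lemma sum_smooth_le_prod z N :
  (forall p K, prime p -> \sum_(k < K) f (p ^ k)%N <= E p) ->
  \sum_(1 <= n < N | smooth z n) f n <= \prod_(p < z | prime p) E p.
Proof.
move=> fE.
(* Exponents below [N] reach every smooth [n < N], because [logn p n < n]. *)
apply: (@le_trans _ _ (\prod_(p < z | prime p) \sum_(k < N) f (p ^ k)%N)); last first.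
  apply: ler_prod => p pp; rewrite fE// andbT sumr_ge0// => k _.
  by rewrite f0// expn_gt0 prime_gt0.
rewrite -sum_smooth_numbers// -big_filter.
apply: (@ler_sum_subset R nat f predT _ (smooth_numbers N z)).
- by rewrite filter_uniq// iota_uniq.
- exact: smooth_numbers_uniq.
- move=> n; rewrite mem_filter mem_index_iota => /and3P[sn n0 nN]; split => //.
  apply: mem_smooth_numbers => // p pp.
  by rewrite (leq_trans _ nN)// ltnS ltnW// ltn_logl.
- by move=> n nz; apply: f0; case: (smooth_numbers_smooth nz).
Qed.

Lemma cvg_prod (I : Type) (r : seq I) (P : pred I) (F : I -> nat -> R) (l : I -> R) :
  (forall i, P i -> (F i @ \oo --> l i)%classic) ->
  ((fun n => \prod_(i <- r | P i) F i n) @ \oo --> \prod_(i <- r | P i) l i)%classic.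
Proof.
move=> Fl; elim: r => [|i r IH].
  by under eq_fun do rewrite big_nil; rewrite big_nil; exact: cvg_cst.
under eq_fun do rewrite big_cons; rewrite big_cons.
by case: ifPn => // Pi; apply: cvgM => //; exact: Fl.
Qed.

(** Each truncated product is a sum over finitely many smooth numbers, hence part of a sum up to
    their maximum; then [K] tends to infinity with the finite set of primes fixed. *)
Lemma prod_le_of_sum_smooth z (B : R) :
  (forall p, prime p -> ((fun K => \sum_(k < K) f (p ^ k)%N) @ \oo --> E p)%classic) ->
  (forall N, \sum_(1 <= n < N | smooth z n) f n <= B) ->
  \prod_(p < z | prime p) E p <= B.
Proof.
move=> fE sB.
have C := @cvg_prod _ (index_enum 'I_z) (fun p => prime p)
  (fun p K => \sum_(k < K) f (p ^ k)%N) (fun p => E p) (fun p pp => fE p pp).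
rewrite -(cvg_lim (@Rhausdorff R) C); apply: limr_le; first exact: cvgP C.
apply: nearW => K; rewrite -sum_smooth_numbers//.
apply: le_trans (sB (\max_(n <- smooth_numbers K z) n).+1).
apply: ler_sum_subset; [exact: smooth_numbers_uniq|exact: iota_uniq| |].
  move=> n nz; have [n0 sn] := smooth_numbers_smooth nz.
  by rewrite mem_index_iota n0 ltnS (@leq_bigmax_seq _ _ xpredT (fun n => n)).
by move=> n; rewrite mem_index_iota => /andP[n0 _]; exact: f0.
Qed.

End EulerProductBounds.

(** * The value of zeta(2) *)

(* The identity [1/sin^2 t = (1/sin^2(t/2) + 1/sin^2(pi/2 - t/2)) / 4], iterated
   from [t = pi/4], evaluates the sum of [1/sin^2] over the odd multiples of
   [pi / 2^(n+2)] below [pi/2]; compare with [1/t^2 <= 1/sin^2 t <= 1 + 1/t^2]. *)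
Section Basel.
Variable R : realType.

Lemma inv_sqr_sin_half (t : R) : sin t != 0 ->
  (sin t ^+ 2)^-1 = 4^-1 * ((sin (t / 2) ^+ 2)^-1 + (sin (pi / 2 - t / 2) ^+ 2)^-1).
Proof.
have -> : sin (pi / 2 - t / 2) = cos (t / 2) by rewrite addrC sinDpihalf cosN.
have {1 2}-> : t = t / 2 *+ 2 by rewrite mulr2n; field.
rewrite sin_mulr2n mulrn_eq0 /= mulf_eq0 negb_or => /andP[c0 s0].
have cs := cos2Dsin2 (t / 2).
move: (cos _) (sin _) c0 s0 cs => c s c0 s0 cs.
have -> : (s ^+ 2)^-1 + (c ^+ 2)^-1 = (c ^+ 2 + s ^+ 2) / (s ^+ 2 * c ^+ 2).
  by field; rewrite c0 s0.
by rewrite cs; field; rewrite c0 s0.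
Qed.

Let angle n k : R := (2 * k%:R + 1) * pi / 2 ^+ (n + 2).

Let angle_bounds n k : (k < 2 ^ n)%N -> 0 < angle n k < pi / 2.
Proof.
move=> kn; have p0 := pi_gt0 R.
have k0 : (0 : R) <= k%:R by [].
have P0 : (0 : R) < 2 ^+ (n + 2) by rewrite exprn_gt0.
have a0 : 0 < 2 * k%:R + 1 :> R by lra.
rewrite /angle divr_gt0 ?mulr_gt0//=.
rewrite ltr_pdivrMr// exprD.
have : k.+1%:R <= 2 ^+ n :> R by rewrite -natrX ler_nat.
rewrite -natr1; move: (2 ^+ n) => y ky.
rewrite [ltRHS](_ : _ = (2 * y) * pi); last by field.
by rewrite ltr_pM2r//; lra.
Qed.

Lemma sum_inv_sqr_sin n :
  \sum_(0 <= k < 2 ^ n) (sin (angle n k) ^+ 2)^-1 = 2 * 4 ^+ n.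
Proof.
elim: n => [|n IH].
  rewrite expn0 big_nat1 expr0 mulr1 /angle mulr0 add0r mul1r.
  have -> : pi / 2 ^+ (0 + 2) = pi / 4 :> R by congr (_ / _); rewrite expr2; lra.
  have /eqP := tan_piquarter R; rewrite /tan => /eqP ht.
  have c0 : cos (pi / 4) != 0 :> R.
    rewrite gt_eqF// cos_gt0_pihalf//; have := pi_gt0 R; lra.
  have sc : sin (pi / 4) = cos (pi / 4) :> R.
    exact: divr1_eq.
  have := cos2Dsin2 (pi / 4 : R); rewrite sc => h.
  have -> : cos (pi / 4) ^+ 2 = 2^-1 :> R by lra.
  by rewrite invrK.
have half k : angle n.+1 k = angle n k / 2.
  by rewrite /angle addSn exprS; field; rewrite expf_neq0.
rewrite (@big_cat_nat _ _ _ (2 ^ n))//=; last by rewrite leq_exp2l.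
(* Reversal of the upper half: the angles of level [n + 1] with index at least [2^n] are the
   complements to [pi/2] of those below, and the latter are the halves of the angles of level
   [n]. *)
rewrite [X in _ + X]big_nat_rev /= [X in _ + X](_ : _ = \sum_(0 <= k < 2 ^ n)
    (sin (pi / 2 - angle n k / 2) ^+ 2)^-1).
  rewrite -big_split /= exprS mulrCA -IH mulr_sumr big_nat [RHS]big_nat.
  apply: eq_bigr => k /andP[_ kn]; rewrite half (@inv_sqr_sin_half (angle n k)) ?mulrA ?divff ?mul1r//.
  have /andP[a0 a1] := angle_bounds kn.
  by rewrite gt_eqF// sin_gt0_pihalf// a0.
rewrite -{1}[(2 ^ n)%N]add0n big_addn.
have -> : (2 ^ n.+1 - 2 ^ n = 2 ^ n)%N by rewrite expnS mul2n -addnn addnK.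
rewrite big_nat [RHS]big_nat; apply: eq_bigr => k /andP[_ kn].
rewrite -half; congr ((sin _ ^+ 2)^-1).
have -> : (2 ^ n + 2 ^ n.+1 - (k + 2 ^ n).+1 = 2 ^ n.+1 - k.+1)%N.
  by rewrite -addSn addnC subnDr.
rewrite /angle natrB; last by rewrite (leq_trans kn)// leq_exp2l.
rewrite natrX !addSn !exprS -natr1 exprD; field.
by rewrite expf_neq0.
Qed.

(** Over [2^n] angles the two bounds on [1/sin^2] differ by [2^n], against a main term [2 * 4^n];
    dividing leaves an error of order [2^(-n)]. *)
Lemma sum_odd_inv_sqr n :
  `|pi ^+ 2 / 8 - \sum_(0 <= k < 2 ^ n) ((2 * k%:R + 1) ^+ 2)^-1| <= pi ^+ 2 / 2 ^+ n :> R.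
Proof.
have p0 := pi_gt0 R.
set S := \sum_(0 <= k < _) _.
have P0 : (0 : R) < 2 ^+ n by rewrite exprn_gt0.
have hk k : (k < 2 ^ n)%N -> ((angle n k) ^+ 2)^-1 = 16 * 4 ^+ n / pi ^+ 2 * ((2 * k%:R + 1) ^+ 2)^-1.
  move=> _; rewrite /angle exprD (_ : 4 = 2 * 2 :> R); last by lra.
  rewrite [(2 * 2) ^+ n]exprMn; have k0 : (0 : R) <= k%:R by [].
  field; rewrite !gt_eqF//; lra.
have hS : \sum_(0 <= k < 2 ^ n) ((angle n k) ^+ 2)^-1 = 16 * 4 ^+ n / pi ^+ 2 * S.
  by rewrite mulr_sumr !big_nat; apply: eq_bigr => k /andP[_ kn]; exact: hk.
have bnd k : (k < 2 ^ n)%N ->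
    ((angle n k) ^+ 2)^-1 <= (sin (angle n k) ^+ 2)^-1 <= 1 + ((angle n k) ^+ 2)^-1.
  move=> /angle_bounds; move: (angle n k) => t /andP[t0 t1].
  have s0 : 0 < sin t by rewrite sin_gt0_pihalf// t0.
  have c0 : 0 < cos t by rewrite cos_gt0_pihalf//; lra.
  have st := sin_le_id (ltW t0).
  rewrite lef_pV2 ?posrE ?exprn_gt0// lerXn2r ?nnegrE ?(ltW s0) ?(ltW t0)//=.
  have ts : t * cos t <= sin t by apply: mul_cos_le_sin; lra.
  have cs := cos2Dsin2 t.
  have -> : (sin t ^+ 2)^-1 = 1 + cos t ^+ 2 / sin t ^+ 2.
    by rewrite (cos2sin2 t); field; rewrite gt_eqF.
  rewrite lerD2l ler_pdivrMr ?exprn_gt0// mulrC ler_pdivlMr ?exprn_gt0//.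
  by rewrite -exprMn [cos t * t]mulrC lerXn2r ?nnegrE ?mulr_ge0 ?(ltW s0) ?(ltW t0) ?(ltW c0).
have lo : 16 * 4 ^+ n / pi ^+ 2 * S <= 2 * 4 ^+ n.
  rewrite -hS -sum_inv_sqr_sin !big_nat; apply: ler_sum => k /andP[_ kn].
  by case/andP: (bnd k kn).
have hi : 2 * 4 ^+ n <= 2 ^+ n + 16 * 4 ^+ n / pi ^+ 2 * S.
  rewrite -hS -sum_inv_sqr_sin.
  have -> : 2 ^+ n = \sum_(0 <= k < 2 ^ n) (1 : R).
    by rewrite sumr_const_nat subn0 -natrX.
  rewrite -big_split /= !big_nat; apply: ler_sum => k /andP[_ kn].
  by case/andP: (bnd k kn).
move: lo hi; rewrite (_ : 4 = 2 * 2 :> R); last by lra.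
rewrite exprMn; move: (2 ^+ n) P0 => y y0.
have pp : 0 < pi ^+ 2 :> R by rewrite exprn_gt0.
move: (pi ^+ 2) pp => P pp; rewrite -!mulrA.
rewrite [16 * _](_ : _ = (y * (y * (16 * S))) / P); last by ring.
rewrite ler_pdivrMr// -lerBlDl ler_pdivlMr// => lo hi.
have {}lo : 16 * S <= 2 * P.
  by rewrite -(ler_pM2l (mulr_gt0 y0 y0)); lra.
have {}hi : (2 * y - 1) * P <= y * (16 * S) by rewrite -(ler_pM2l y0); lra.
rewrite ler_norml; apply/andP; split.
  have : 0 <= P / y by rewrite divr_ge0 ?ltW.
  lra.
by rewrite ler_pdivlMr//; lra.
Qed.

Definition zeta2_partial (m : nat) : R := \sum_(1 <= k < m.+1) (k%:R ^+ 2)^-1.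

Lemma zeta2_partial_double N : zeta2_partial (N.*2) =
  \sum_(0 <= k < N) ((2 * k%:R + 1) ^+ 2)^-1 + 4^-1 * zeta2_partial N.
Proof.
elim: N => [|N IH]; first by rewrite /zeta2_partial !big_geq// mulr0 addr0.
rewrite {1}/zeta2_partial doubleS big_nat_recr//= big_nat_recr//= -/(zeta2_partial _) IH.
rewrite big_nat_recr//= [X in _ = _ + _ * X]big_nat_recr//= -/(zeta2_partial _).
have -> : N.*2.+1%:R = 2 * N%:R + 1 :> R by rewrite -natr1 -mul2n natrM.
have -> : N.*2.+2%:R = 2 * N.+1%:R :> R by rewrite -doubleS -mul2n natrM.
have -> : ((2 * N.+1%:R) ^+ 2)^-1 = 4^-1 * (N.+1%:R ^+ 2)^-1 :> R.
  by rewrite exprMn invfM; congr (_^-1 * _); rewrite expr2; lra.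
by ring.
Qed.

Lemma eq0_norm_le_inv_succ (a C : R) : (forall m, `|a| <= C * m.+1%:R^-1) -> a = 0.
Proof.
move=> aC; apply/eqP; rewrite -normr_le0.
have H : ((fun m => C * m.+1%:R^-1) @ \oo --> (0 : R))%classic.
  rewrite -[X in (_ --> X)%classic](mulr0 C); apply: cvgM; first exact: cvg_cst.
  exact: cvg_harmonic.
rewrite -(cvg_lim (@Rhausdorff R) H); apply: limr_ge; first exact: cvgP H.
exact: nearW.
Qed.

Lemma zeta2_partial_diff m n : (m <= n)%N ->
  0 <= zeta2_partial n.+1 - zeta2_partial m.+1 <= m.+1%:R^-1 - n.+1%:R^-1.
Proof.
move=> /subnKC <-; elim: (n - m)%N => [|k]; first by rewrite addn0 !subrr lexx.
rewrite addnS => /andP[h0 h1].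
have E : zeta2_partial (m + k).+2 = zeta2_partial (m + k).+1 + ((m + k).+2%:R ^+ 2)^-1.
  by rewrite {1}/zeta2_partial big_nat_recr.
have s0 : 0 <= ((m + k).+2%:R ^+ 2)^-1 :> R by rewrite invr_ge0 exprn_ge0.
have s1 : ((m + k).+2%:R ^+ 2)^-1 <= (m + k).+1%:R^-1 - (m + k).+2%:R^-1 :> R.
  have a0 : (0 : R) < (m + k).+1%:R by rewrite ltr0n.
  rewrite -(natr1 (m + k).+1); move: ((m + k).+1%:R) a0 => a a0.
  have -> : a^-1 - (a + 1)^-1 = (a * (a + 1))^-1 by field; rewrite !gt_eqF//; lra.
  rewrite lef_pV2 ?posrE ?mulr_gt0 ?exprn_gt0//; [|lra..].
  by rewrite expr2 ler_pM2r; lra.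
rewrite E; move: s0 s1 h0 h1.
move: ((m + k).+2%:R ^+ 2)^-1 (m + k).+1%:R^-1 (m + k).+2%:R^-1 m.+1%:R^-1 => a b c d.
by move: (zeta2_partial _) (zeta2_partial _) => e f *; lra.
Qed.

Lemma basel m : (0 < m)%N ->
  zeta2_partial m <= pi ^+ 2 / 6 <= zeta2_partial m + m%:R^-1.
Proof.
have [||z cz zb] := @cauchy_cvg_rate R (fun n => zeta2_partial n.+1) (fun n => n.+1%:R^-1).
- exact: cvg_harmonic.
- move=> a b /zeta2_partial_diff/andP[h0 h1]; rewrite ger0_norm// (le_trans h1)//.
  by rewrite gerBl invr_ge0.
have -> : pi ^+ 2 / 6 = z.
  apply/eqP; rewrite -subr_eq0; apply/eqP.
  (* In the limit [zeta2_partial_double] reads [z = pi^2/8 + z/4]; the factor [4/3] comes from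
     solving for [z]. *)
  apply: (@eq0_norm_le_inv_succ _ (4 / 3 * (pi ^+ 2 + 1 + 1) * 2)) => n.
  have n1 : (n.+1 <= 2 ^ n)%N by rewrite ltn_expl.
  have z1 := zb (2 ^ n).-1; rewrite prednK ?expn_gt0// natrX in z1.
  have z2 := zb (2 ^ n.+1).-1; rewrite prednK ?expn_gt0// natrX in z2.
  have o1 := sum_odd_inv_sqr n.
  move: z2; rewrite expnS mul2n zeta2_partial_double.
  have i1 : (2 ^+ n)^-1 <= n.+1%:R^-1 :> R.
    by rewrite lef_pV2 ?posrE ?exprn_gt0 ?ltr0n// -natrX ler_nat.
  have i2 : (2 ^+ n.+1)^-1 <= n.+1%:R^-1 :> R.
    rewrite (le_trans _ i1)// lef_pV2 ?posrE ?exprn_gt0// exprS.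
    by rewrite ler_peMl// ?exprn_ge0// ler1n.
  move: i1 i2 o1 z1.
  have pp : 0 < pi ^+ 2 :> R by rewrite exprn_gt0// pi_gt0.
  move: (2 ^+ n)^-1 (2 ^+ n.+1)^-1 n.+1%:R^-1 (pi ^+ 2) pp => a b c P pp ac bc.
  have Pac : P * a <= P * c by rewrite ler_pM2l.
  move: (\sum_(_ <= _ < _) _) (zeta2_partial _) => s t.
  by rewrite !ler_norml; lra.
case: m => // m _; apply/andP; split; last first.
  by have := zb m; move: m.+1%:R^-1 (zeta2_partial m.+1) => a b; rewrite ler_norml; lra.
have nd : nondecreasing_seq (fun n => zeta2_partial n.+1).
  by move=> a b /zeta2_partial_diff/andP[]; rewrite subr_ge0.
by have := nondecreasing_cvgn_le nd (cvgP _ cz) m; rewrite (cvg_lim (@Rhausdorff R) cz).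
Qed.

End Basel.

(** * Local Euler factors *)

Section LocalFactor.
Variables (R : realType) (t z : R).
Hypothesis t01 : [\/ t = 0, t = 1 | t = -1].
Hypothesis z01 : 0 <= z < 1.

(** The coefficients [g k = 1 + t + ... + t^k] satisfy [g k.+1 = 1 + t * g k], so multiplying by
    [1 - t * z] leaves the plain geometric series and one boundary term. *)
Lemma local_factor_identity K :
  (1 - t * z) * \sum_(k < K) (\sum_(i < k.+1) t ^+ i) * z ^+ k =
  \sum_(k < K) z ^+ k - t * (\sum_(i < K) t ^+ i) * z ^+ K.
Proof.
elim: K => [|K IH]; first by rewrite !big_ord0; ring.
rewrite big_ord_recr /= mulrDr IH [X in _ = X - _]big_ord_recr /=.
have -> : \sum_(i < K.+1) t ^+ i = 1 + t * \sum_(i < K) t ^+ i.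
  rewrite big_ord_recl expr0 mulr_sumr; congr (_ + _).
  by apply: eq_bigr => i _; rewrite -exprS.
by rewrite exprS; ring.
Qed.

(** For [t = 1] the boundary term is of size [K * z^K]. With [s = sqrt z], one factor [s^K] absorbs
    [K], since [K * s^K] is at most the geometric sum, and the other tends to 0. *)
Lemma cvg_mul_expr : ((fun K => K%:R * z ^+ K) @ \oo --> (0 : R))%classic.
Proof.
have /andP[z0 z1] := z01; set s := Num.sqrt z.
have s0 : 0 <= s by rewrite sqrtr_ge0.
have s1 : s < 1 by rewrite -[ltRHS]sqrtr1 ltr_sqrt.
have geo K : K%:R * s ^+ K <= (1 - s)^-1.
  have H : (1 - s) * \sum_(k < K) s ^+ k = 1 - s ^+ K.
    by rewrite -[1 - s]opprB mulNr -subrX1 opprB.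
  rewrite -[leRHS]mul1r ler_pdivlMr; last by lra.
  have : K%:R * s ^+ K <= \sum_(k < K) s ^+ k.
    rewrite mulr_natl -[X in _ *+ X]card_ord -sumr_const.
    by apply: ler_sum => k _; apply: ler_wiXn2l; rewrite ?(ltnW (ltn_ord k))// ltW.
  have s1' : 0 <= 1 - s by lra.
  move=> /(ler_wpM2l s1'); rewrite H; have := exprn_ge0 K s0; lra.
apply: (@squeeze_cvgr _ _ _ _ (fun=> 0) (fun K => (1 - s)^-1 * s ^+ K)).
- apply: nearW => K; rewrite mulr_ge0 ?exprn_ge0//=.
  have -> : z ^+ K = s ^+ K * s ^+ K by rewrite -exprMn -expr2 sqr_sqrtr.
  by rewrite mulrA ler_wpM2r ?exprn_ge0.
- exact: cvg_cst.
- rewrite -[X in (_ --> X)%classic](mulr0 (1 - s)^-1).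
  apply: cvgM; first exact: cvg_cst.
  by apply: cvg_expr; rewrite ger0_norm.
Qed.

Lemma cvg_local_factor :
  ((fun K => \sum_(k < K) (\sum_(i < k.+1) t ^+ i) * z ^+ k) @ \oo -->
    (1 - z)^-1 * (1 - t * z)^-1)%classic.
Proof.
have /andP[z0 z1] := z01.
have tz : 1 - t * z != 0 by rewrite gt_eqF//; case: t01 => ->; lra.
have nt k : `|t| ^+ k <= 1 by rewrite exprn_ile1//; case: t01 => ->; rewrite ?normrN ?normr0 ?normr1.
have -> : (fun K => \sum_(k < K) (\sum_(i < k.+1) t ^+ i) * z ^+ k) =
  (fun K => (\sum_(k < K) z ^+ k - t * (\sum_(i < K) t ^+ i) * z ^+ K) * (1 - t * z)^-1).
  by apply/funext => K; rewrite -local_factor_identity mulrC mulKf.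
apply: cvgM; last exact: cvg_cst.
rewrite -[X in (_ --> X)%classic]subr0; apply: cvgB.
  have -> : (fun K => \sum_(k < K) z ^+ k) = series (geometric 1 z).
    apply/funext => K; rewrite /series /= big_mkord.
    by apply: eq_bigr => k _; rewrite /geometric /= mul1r.
  by rewrite -[X in (_ --> X)%classic]mul1r; apply: cvg_geometric_series; rewrite ger0_norm.
apply/norm_cvg0P; apply: (@squeeze_cvgr _ _ _ _ (fun=> 0) (fun K => K%:R * z ^+ K)).
- apply: nearW => K; rewrite normr_ge0/= !normrM (ger0_norm (exprn_ge0 K z0)).
  rewrite ler_wpM2r ?exprn_ge0//.
  have t1 := nt 1%N; rewrite expr1 in t1.
  rewrite (le_trans (ler_piMl _ t1))// (le_trans (ler_norm_sum _ _ _))//.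
  rewrite -[leRHS](_ : \sum_(i < K) 1 = _); last by rewrite sumr_const card_ord.
  by apply: ler_sum => i _; rewrite normrX.
- exact: cvg_cst.
- exact: cvg_mul_expr.
Qed.

Lemma local_factor_le K :
  \sum_(k < K) (\sum_(i < k.+1) t ^+ i) * z ^+ k <= (1 - z)^-1 * (1 - t * z)^-1.
Proof.
have /andP[z0 z1] := z01.
have nd : nondecreasing_seq (fun K => \sum_(k < K) (\sum_(i < k.+1) t ^+ i) * z ^+ k).
  apply/nondecreasing_seqP => n; rewrite big_ord_recr /= lerDl.
  by rewrite mulr_ge0 ?exprn_ge0// geometric_sign_ge0.
have := nondecreasing_cvgn_le nd (cvgP _ cvg_local_factor) K.
by rewrite (cvg_lim (@Rhausdorff R) cvg_local_factor).
Qed.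

End LocalFactor.

(** * Real characters *)

Section QuadraticCharacterValues.
Variables (R : realType) (q : nat) (chi : nat -> R[i]).
Hypothesis qchi : quadratic_character q chi.

Let chiD : dirichlet_character q chi. Proof. by case: qchi. Qed.
Let q_gt0 : (0 < q)%N := dirichlet_modulus_gt0 chiD.
Let chi2 n : chi n ^+ 2 = (coprime n q)%:R. Proof. by case: qchi. Qed.

Lemma quadratic_character_values n : [\/ chi n = 0, chi n = 1 | chi n = -1].
Proof.
have := chi2 n; case: (coprime n q) => /eqP.
  by rewrite sqrf_eq1 => /orP[/eqP->|/eqP->]; [apply: Or32|apply: Or33].
by rewrite expf_eq0 /= => /eqP ->; apply: Or31.
Qed.

Definition real_character n : R := complex.Re (chi n).

Lemma real_characterE : chi = fun n => (real_character n)%:C.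
Proof.
apply/funext => n; rewrite /real_character.
by case: (quadratic_character_values n) => -> //=; rewrite rmorphN.
Qed.

Lemma real_character_values n :
  [\/ real_character n = 0, real_character n = 1 | real_character n = -1].
Proof.
rewrite /real_character.
by case: (quadratic_character_values n) => ->; [apply: Or31|apply: Or32|apply: Or33].
Qed.

Lemma real_characterM m n :
  real_character (m * n) = real_character m * real_character n.
Proof.
have := dirichletM chiD m n; rewrite real_characterE -rmorphM.
by move=> /(congr1 (@complex.Re R)).
Qed.

Lemma dirichlet_character1 : chi 1%N = 1.
Proof.
have h := dirichletM chiD 1 1; rewrite muln1 in h.
have : chi 1%N != 0 by rewrite (dirichlet_neq0 chiD) coprime1n.
by move=> c0; apply: (mulfI c0); rewrite -h mulr1.
Qed.

Lemma real_character1 : real_character 1 = 1.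
Proof. by rewrite /real_character dirichlet_character1. Qed.

Lemma real_character_eq0 n : (real_character n == 0) = ~~ coprime n q.
Proof.
rewrite -(dirichlet_neq0 chiD) negbK [in RHS]real_characterE.
by apply/eqP/eqP => [->//|] /complexI.
Qed.

Lemma real_character_eq1 n : (chi n == 1) = (real_character n == 1).
Proof. by rewrite [in LHS]real_characterE; apply/eqP/eqP => [/complexI|->]. Qed.

Lemma dirichlet_character_mod n : chi n = chi (n %% q).
Proof.
rewrite [in LHS](divn_eq n q); elim: (n %/ q)%N => [|k IH]; first by rewrite mul0n.
by rewrite mulSn -addnA addnC (dirichlet_periodic chiD).
Qed.

Lemma quadratic_character_neg : exists2 a, coprime a q & chi a = -1.
Proof.
case: qchi => _ _ np; apply: contrapT => H; apply: np; apply/funext => n.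
rewrite /principal_character; have [cn|cn] := boolP (coprime n q).
  case: (quadratic_character_values n) => // h; last by exfalso; apply: H; exists n.
  by have := dirichlet_neq0 chiD n; rewrite h eqxx cn.
by apply/eqP; rewrite -[_ == _]negbK (dirichlet_neq0 chiD).
Qed.

Lemma quadratic_modulus_ge3 : (3 <= q)%N.
Proof.
have [a ca ha] := quadratic_character_neg.
rewrite leqNgt; apply/negP => q2.
suff : chi a = 1.
  by rewrite ha => /eqP; rewrite eq_sym -subr_eq0 opprK -mulr2n mulrn_eq0 oner_eq0.
rewrite dirichlet_character_mod -dirichlet_character1 [RHS]dirichlet_character_mod.
congr chi; case: q q2 ca q_gt0 => [|[|[|//]]] // _; first by rewrite !modn1.
by rewrite coprimen2 !modn2 => ->.
Qed.

(** Multiplication by a residue where the character is [-1] permutes the residues and reverses the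
    sign of the sum. *)
Lemma sum_real_character_period : \sum_(i < q) real_character i = 0.
Proof.
have [a ca ha] := quadratic_character_neg.
have xa : real_character a = -1 by rewrite /real_character ha.
pose h (i : 'I_q) : 'I_q := Ordinal (ltn_pmod (a * i) q_gt0).
have hinj : injective h.
  have aux (i j : 'I_q) : (i <= j)%N -> a * i = a * j %[mod q] -> i = j.
    move=> ij /esym/eqP; rewrite eqn_mod_dvd ?leq_mul2l ?ij ?orbT//.
    rewrite -mulnBr Gauss_dvdr 1?coprime_sym// => /dvdn_leq H.
    apply/val_inj/eqP; rewrite eqn_leq ij/= -subn_eq0 -leqn0 leqNgt.
    apply/negP => /H; rewrite leqNgt => /negP; apply.
    by rewrite (leq_ltn_trans (leq_subr _ _)).
  move=> i j /(congr1 val) /= e.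
  by case/orP: (leq_total i j) => ij; [|apply/esym]; exact: aux.
have H : \sum_(i < q) real_character i = - \sum_(i < q) real_character i.
  rewrite {1}(reindex_inj hinj) -sumrN; apply: eq_bigr => i _.
  rewrite {1}/real_character /= -dirichlet_character_mod -/(real_character _).
  by rewrite real_characterM xa mulN1r.
by move: H; move: (\sum_(i < q) _) => s; lra.
Qed.

Lemma sum_real_character_shift N : \sum_(N <= n < N + q) real_character n = 0.
Proof.
elim: N => [|N IH].
  by rewrite add0n big_mkord sum_real_character_period.
move: IH; rewrite addSn; case: q q_gt0 (dirichlet_periodic chiD N) => // k _ per.
rewrite addnS big_nat_recl ?leq_addr// [in X in _ -> X]big_nat_recr/=; last first.
  by rewrite -addSn leq_addr.
have -> : real_character (N + k).+1 = real_character N.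
  by rewrite -addnS /real_character per.
by rewrite big_add1 /= addrC.
Qed.

Lemma sum_real_character_bound N : `|\sum_(1 <= n < N) real_character n| <= q%:R.
Proof.
have xle n : `|real_character n| <= 1.
  by case: (real_character_values n) => ->; rewrite ?normrN ?normr0 ?normr1.
elim/ltn_ind: N => N IH.
have [Nq|qN] := leqP N q.
  rewrite (le_trans (ler_norm_sum _ _ _))//.
  apply: (@le_trans _ _ (\sum_(1 <= n < N) (1 : R))); first exact: ler_sum.
  by rewrite sumr_const_nat ler_nat (leq_trans (leq_subr _ _)).
have eN : N = (N - q + q)%N by rewrite subnK// ltnW.
rewrite (@big_cat_nat _ _ _ (N - q))//=; [|by rewrite subn_gt0|exact: leq_subr].
rewrite [X in _ + X](_ : _ = 0); last by rewrite {2}eN sum_real_character_shift.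
by rewrite addr0; apply: IH; rewrite ltn_subrL q_gt0 (leq_trans _ qN).
Qed.

End QuadraticCharacterValues.

(** * Large primes and the tail of the smooth sum *)

Section LargePrimes.
Variables (R : realType) (x : nat -> R).
Hypothesis xM : forall m n, x (m * n)%N = x m * x n.
Hypothesis x1 : x 1%N = 1.
Hypothesis x01 : forall n, [\/ x n = 0, x n = 1 | x n = -1].

(** Distinct primes dividing [m] have a product dividing [m], so [q ^ size s <= m < q ^ c]. *)
Lemma large_prime_divisors_count (s : seq nat) q m c : (1 < q)%N -> (0 < m)%N ->
  (m < q ^ c)%N -> uniq s ->
  all (fun p => [&& prime p, (p %| m)%N & (q <= p)%N]) s -> (size s <= c)%N.
Proof.
move=> q1 m0 mc us al.
have dv : (\prod_(p <- s) p %| m)%N.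
  elim: s us al => [|p s IH] /=; first by rewrite big_nil dvd1n.
  move=> /andP[ps us] /andP[/and3P[pp pm _] al]; rewrite big_cons.
  rewrite Gauss_dvd ?pm ?IH//.
  rewrite big_seq; elim/big_ind: _ => [|a b ca cb|r rs].
  - by rewrite coprimen1.
  - by rewrite coprimeMr ca.
  rewrite prime_coprime// dvdn_prime2//; last by case/and3P: (allP al _ rs).
  by apply: contra ps => /eqP ->.
have qs : (q ^ size s <= \prod_(p <- s) p)%N.
  elim: s al {us dv} => [|p s IH] /=; first by rewrite big_nil.
  move=> /andP[/and3P[_ _ qp] al]; rewrite big_cons expnS.
  by rewrite leq_mul// IH.
rewrite ltnW// -(ltn_exp2l _ _ q1) (leq_ltn_trans qs)// (leq_ltn_trans _ mc)//.
by rewrite dvdn_leq.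
Qed.

Definition lam_prime_sum (q N0 : nat) : R :=
  \sum_(q.+1 <= p < N0.+1 | prime p) lam x p / p%:R.

Lemma lam_div_ge0 n : (0 < n)%N -> 0 <= lam x n / n%:R.
Proof. by move=> n0; rewrite divr_ge0 ?lam_ge0. Qed.

(* Multiplying by a prime [p] in [(q, N0]] moves the range [[a, b)] into
   [[a q, b N0)], and each [m] is hit at most [c] times. *)
Lemma lam_prime_sum_shift (q N0 a b c : nat) : (1 < q)%N -> (0 < a)%N -> (0 < N0)%N ->
  (b * N0 <= q ^ c)%N ->
  lam_prime_sum q N0 * (\sum_(a <= n < b) lam x n / n%:R) <=
  2 * c%:R * \sum_(a * q <= m < b * N0) lam x m / m%:R.
Proof.
move=> q1 a0 N00 bc; pose F m := lam x m / m%:R.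
have aq0 : (0 < a * q)%N by rewrite muln_gt0 a0 ltnW.
have step p : (q < p)%N -> (p < N0.+1)%N -> prime p ->
    lam x p / p%:R * (\sum_(a <= n < b) F n) <=
    2 * \sum_(a * q <= m < b * N0 | (p %| m)%N) F m.
  move=> qp pN pp; have p0 := prime_gt0 pp.
  apply: (@le_trans _ _ (2 * \sum_(a <= n < b) F (p * n)%N)).
    rewrite !mulr_sumr big_nat [leRHS]big_nat; apply: ler_sum => n /andP[an _].
    have n0 : (0 < n)%N by exact: leq_trans an.
    rewrite /F mulf_div mulrA natrM ler_wpM2r ?invr_ge0 ?mulr_ge0//.
    exact: lam_prime_mul_le.
  rewrite ler_pM2l// -(big_map (fun n => p * n)%N xpredT F).
  apply: ler_sum_subset; last 2 first.
  - move=> m /mapP[n]; rewrite mem_index_iota => /andP[an nb] ->.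
    split; last exact: dvdn_mulr.
    rewrite mem_index_iota mulnC leq_mul ?(ltnW qp)//=.
    apply: (@leq_trans (b * p)); first by rewrite mulnC ltn_pmul2r.
    by rewrite leq_mul2l -ltnS pN orbT.
  - move=> m; rewrite mem_index_iota => /andP[am _].
    by rewrite lam_div_ge0// (leq_trans aq0).
  - rewrite map_inj_uniq ?iota_uniq// => i j /eqP.
    by rewrite eqn_pmul2l// => /eqP.
  - exact: iota_uniq.
rewrite /lam_prime_sum mulr_suml.
apply: (@le_trans _ _ (\sum_(q.+1 <= p < N0.+1 | prime p)
    2 * \sum_(a * q <= m < b * N0 | (p %| m)%N) F m)).
  rewrite big_nat_cond [leRHS]big_nat_cond; apply: ler_sum => p /andP[/andP[qp pN] pp].
  exact: step.
rewrite -mulr_sumr -mulrA ler_pM2l//.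
under eq_bigr do rewrite big_mkcond.
rewrite exchange_big /= mulr_sumr big_nat [leRHS]big_nat.
apply: ler_sum => m /andP[am mb].
have m0 : (0 < m)%N by exact: leq_trans am.
rewrite -big_mkcondr /= -big_filter.
set s := [seq _ <- _ | _]; rewrite (eq_bigr (fun=> F m))//.
have -> : \sum_(i <- s) F m = (size s)%:R * F m.
  by rewrite big_const_seq count_predT iter_addr_0 mulr_natl.
rewrite ler_wpM2r ?lam_div_ge0// ler_nat.
apply: (@large_prime_divisors_count _ q m) => //.
- exact: leq_trans bc.
- by rewrite filter_uniq// iota_uniq.
apply/allP => p; rewrite mem_filter mem_index_iota => /andP[/andP[-> ->] /andP[qp _]].
by rewrite ltnW.
Qed.

(** Four shifts starting from the one-term range [[1, 2)], where the sum is [lam x 1 = 1]. All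
    integers met are below [2 * q^16 <= q^17], so each is hit at most 17 times per shift, and
    [34 = 2 * 17]. *)
Lemma lam_prime_sum_pow4 (q : nat) : (1 < q)%N ->
  lam_prime_sum q (q ^ 4) ^+ 4 <=
  34 ^+ 4 * \sum_(q ^ 4 <= n < 2 * q ^ 16) lam x n / n%:R.
Proof.
move=> q1; set Q := lam_prime_sum _ _.
have q0 : (0 < q)%N by exact: ltnW.
have Q0 : 0 <= Q.
  rewrite /Q /lam_prime_sum big_nat_cond; apply: sumr_ge0 => p /andP[/andP[qp _] _].
  by rewrite lam_div_ge0// (leq_trans _ qp).
suff H j : (j <= 4)%N -> Q ^+ j <=
    34 ^+ j * \sum_(q ^ j <= n < 2 * q ^ (4 * j)) lam x n / n%:R by exact: (H 4%N).
elim: j => [_|j IH j4].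
  by rewrite !expr0 mul1r muln0 expn0 muln1 big_nat1 lam1// divr1.
rewrite exprS (le_trans (ler_wpM2l Q0 (IH (ltnW j4))))// mulrCA [in leRHS]exprSr -[leRHS]mulrA.
rewrite ler_wpM2l ?exprn_ge0//.
have -> : 34 = 2 * 17%:R :> R by rewrite -natrM.
rewrite [in leRHS]expnSr mulnS addnC expnD mulnA.
apply: lam_prime_sum_shift => //; rewrite ?expn_gt0 ?q0//.
rewrite -mulnA -expnD (leq_trans (n := q ^ (1 + (4 * j + 4))))//.
  by rewrite [leqRHS]expnD leq_mul2r expn1 q1 orbT.
by rewrite leq_exp2l//; lia.
Qed.

End LargePrimes.

Section SmoothTruncation.
Variables (R : realType) (x : nat -> R).
Hypothesis xM : forall m n, x (m * n)%N = x m * x n.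
Hypothesis x1 : x 1%N = 1.
Hypothesis x01 : forall n, [\/ x n = 0, x n = 1 | x n = -1].

Definition local_factor (z t : R) : R := (1 - z)^-1 * (1 - t * z)^-1.

Definition euler_factor (p : nat) : R := local_factor p%:R^-1 (x p).

Lemma prime_inv_bounds p : prime p -> 0 <= (p%:R^-1 : R) < 1.
Proof. by move=> pp; rewrite invr_ge0 ler0n/= invf_lt1 ?ltr0n ?ltr1n ?prime_gt0 ?prime_gt1. Qed.

Lemma local_factor_gt0 z p : 0 <= z < 1 -> 0 < local_factor z (x p).
Proof.
by move=> /andP[z0 z1]; rewrite mulr_gt0 ?invr_gt0//; case: (x01 p) => e; rewrite ?e; lra.
Qed.

Lemma lam_div_ppow p k : prime p ->
  lam x (p ^ k) / (p ^ k)%:R = (\sum_(i < k.+1) x p ^+ i) * p%:R^-1 ^+ k.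
Proof. by move=> pp; rewrite lam_ppow// natrX exprVn. Qed.

Lemma lam_divM p n k : prime p -> (0 < n)%N -> ~~ (p %| n)%N ->
  lam x (n * p ^ k) / (n * p ^ k)%:R =
  (lam x n / n%:R) * (lam x (p ^ k) / (p ^ k)%:R).
Proof. by move=> pp _ pn; rewrite lamM// natrM mulf_div. Qed.

Lemma inv_onem_le_expR (u : R) : 0 <= u <= 2^-1 -> (1 - u)^-1 <= expR (2 * u).
Proof.
move=> /andP[u0 u1]; have := expR_ge1Dx (2 * u) => h; apply: le_trans h.
rewrite -div1r ler_pdivrMr; nra.
Qed.

(** With [u = 1/p]: for [x p] equal to 0 or 1 the factor is [(1 - u)^-1] or its square, and
    [lam x p] is 1 or 2. For [x p = -1], [lam x p] vanishes and the factor [(1 - u^2)^-1] is what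
    the term in [1/p^2] pays for. *)
Lemma euler_factor_le p : prime p ->
  euler_factor p <= expR (2 * (lam x p / p%:R) + 2 * (p%:R ^+ 2)^-1).
Proof.
move=> pp; rewrite lam_prime// /euler_factor /local_factor -exprVn.
have h : 0 <= (p%:R^-1 : R) <= 2^-1.
  by rewrite invr_ge0 ler0n/= lef_pV2 ?posrE ?ltr0n ?prime_gt0// ler_nat prime_gt1.
move: (p%:R^-1) h => u h; have /andP[u0 u1] := h.
have u2 : 0 <= u ^+ 2 <= 2^-1 by rewrite sqr_ge0/=; nra.
have h1 := inv_onem_le_expR h; have h2 := inv_onem_le_expR u2.
have u20 := sqr_ge0 u.
case: (x01 p) => ->.
- rewrite mul0r subr0 invr1 mulr1 (le_trans h1)// ler_expR; lra.
- rewrite mul1r (@le_trans _ _ (expR (2 * u) * expR (2 * u)))//.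
    by rewrite ler_pM ?invr_ge0//; lra.
  by rewrite -expRD ler_expR; lra.
- have -> : (1 - u)^-1 * (1 - -1 * u)^-1 = (1 - u ^+ 2)^-1.
    by rewrite -invfM; congr _^-1; ring.
  by rewrite (le_trans h2)// ler_expR; lra.
Qed.

Lemma euler_factor_ge1 p : prime p -> 1 <= euler_factor p.
Proof.
move=> pp; have := @local_factor_le R (x p) p%:R^-1 (x01 p) (prime_inv_bounds pp) 1.
by rewrite !big_ord1 !expr0 mulr1.
Qed.

Lemma sum_inv_sqr_range (q M : nat) : (0 < q)%N ->
  \sum_(q.+1 <= n < M.+1) (n%:R ^+ 2)^-1 <= q%:R^-1 :> R.
Proof.
move=> q0; have [qM|Mq] := leqP q M; last by rewrite big_geq ?invr_ge0// ltnW.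
have -> : \sum_(q.+1 <= n < M.+1) (n%:R ^+ 2)^-1 = zeta2_partial R M - zeta2_partial R q.
  by rewrite /zeta2_partial sum_range_cat.
case: q M q0 qM => // q [//|M] _ qM.
have /andP[_ h] := @zeta2_partial_diff R q M qM; rewrite (le_trans h)//.
by rewrite gerBl invr_ge0.
Qed.

(** Every [n <= q^4] has its prime factors up to [q^4], so the whole sum is below the Euler product
    up to [q^4]; the primes above [q] contribute the exponential. *)
Lemma sum_lam_le_prod (q : nat) : (0 < q)%N ->
  \sum_(1 <= n < (q ^ 4).+1) lam x n / n%:R <=
  (\prod_(p < q.+1 | prime p) euler_factor p) *
  expR (2 * lam_prime_sum x q (q ^ 4) + 2 / q%:R).
Proof.
move=> q0; have qM : (q <= q ^ 4)%N by rewrite -[leqLHS]expn1 leq_pexp2l.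
move: (q ^ 4)%N qM => M qM.
apply: (@le_trans _ _ (\prod_(p < M.+1 | prime p) euler_factor p)).
  rewrite (_ : \sum_(1 <= n < M.+1) lam x n / n%:R =
    \sum_(1 <= n < M.+1 | smooth M.+1 n) lam x n / n%:R).
    apply: (@sum_smooth_le_prod R (fun n => lam x n / n%:R)).
    - by rewrite lam1// divr1.
    - by move=> p n k pp n0 pn; exact: lam_divM.
    - by move=> n n0; exact: lam_div_ge0.
    - move=> p K pp; under eq_bigr do rewrite lam_div_ppow//.
      by apply: local_factor_le => //; exact: prime_inv_bounds.
  rewrite big_nat [RHS]big_nat_cond; apply: eq_big => n; last by [].
  apply/idP/idP => [nM|/andP[]//]; rewrite nM /=.
  case/andP: nM => n0 nM; apply/smoothP => // p pp /dvdn_leq -/(_ n0) pn.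
  exact: leq_ltn_trans nM.
rewrite -(big_mkord (fun p => prime p) euler_factor).
rewrite (@big_cat_nat _ _ _ q.+1)//= big_mkord.
apply: ler_wpM2l.
  by apply: prodr_ge0 => p pp; rewrite (le_trans ler01)// euler_factor_ge1.
apply: (@le_trans _ _ (\prod_(q.+1 <= p < M.+1 | prime p)
   expR (2 * (lam x p / p%:R) + 2 * (p%:R ^+ 2)^-1))).
  apply: ler_prod => p pp; rewrite euler_factor_le// andbT.
  by rewrite (le_trans ler01)// euler_factor_ge1.
rewrite -expR_sum ler_expR big_split /= -!mulr_sumr lerD// ler_pM2l//.
rewrite (le_trans _ (sum_inv_sqr_range M q0))//.
by rewrite big_mkcond; apply: ler_sum => p _; case: ifP => // _; rewrite invr_ge0 sqr_ge0.
Qed.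

(* Rankin's trick with weight [w n = n^(1 / (4 ln q))], at most [4/3] at the
   primes [p <= q]. *)
Section Rankin.
Variable q : nat.
Hypothesis q3 : (3 <= q)%N.
Hypothesis lnq1 : 1 <= @ln R q%:R.

Let d : R := (4 * ln q%:R)^-1.
Let w (n : nat) : R := expR (d * ln n%:R).

Let d_gt0 : 0 < d. Proof. by have := lnq1; rewrite invr_gt0; lra. Qed.
Let d_le : d <= 4^-1.
Proof. by have l1 := lnq1; rewrite /d lef_pV2 ?posrE; lra. Qed.

Let wM m n : (0 < m)%N -> (0 < n)%N -> w (m * n) = w m * w n.
Proof. by move=> m0 n0; rewrite /w natrM lnM ?posrE ?ltr0n// mulrDr expRD. Qed.

Let wX p k : (0 < p)%N -> w (p ^ k) = w p ^+ k.
Proof.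
move=> p0; elim: k => [|k IH]; first by rewrite expn0 expr0 /w ln1 mulr0 expR0.
by rewrite expnS exprS wM ?IH// expn_gt0 p0.
Qed.

Let z p : R := w p / p%:R.

Let z_bounds p : prime p -> 0 <= z p < 1.
Proof.
move=> pp; have p0 : (0 : R) < p%:R by rewrite ltr0n prime_gt0.
rewrite /z divr_ge0 ?expR_ge0 ?ler0n//= ltr_pdivrMr// mul1r.
rewrite -[ltRHS]lnK ?posrE// ltr_expR.
have : 0 < ln (p%:R : R) by rewrite ln_gt0// ltr1n prime_gt1.
have := d_le; nra.
Qed.

Let z_small p : prime p -> (p <= q)%N -> z p <= 4 / 3 / p%:R.
Proof.
move=> pp pq; have p0 : (0 : R) < p%:R by rewrite ltr0n prime_gt0.
rewrite /z ler_pM2r ?invr_gt0// /w.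
apply: (@le_trans _ _ (expR 4^-1)).
  have l1 := lnq1; rewrite ler_expR /d ler_pdivrMl; last by lra.
  have : ln p%:R <= ln (q%:R : R).
    by rewrite ler_ln ?posrE ?ler_nat// ltr0n (leq_trans _ q3).
  lra.
by have := @expRB1_le R 4^-1; lra.
Qed.

Let z_factor p : prime p -> (p <= q)%N -> local_factor (z p) (x p) <= expR (8 / p%:R).
Proof.
move=> pp pq.
have /andP[z0 z1] := z_bounds pp; have zs := z_small pp pq.
(* As [z p <= 4 / (3 p) <= 2/3], one has [1 / (1 - z p) <= 1 + 3 * z p <= 1 + 4 / p]. *)
have h1 : (1 - z p)^-1 <= expR (4 / p%:R).
  rewrite (le_trans _ (expR_ge1Dx _))//.
  have u2 : (p%:R^-1 : R) <= 2^-1.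
    by rewrite lef_pV2 ?posrE ?ltr0n ?prime_gt0// ler_nat prime_gt1.
  have u0 : 0 < (p%:R^-1 : R) by rewrite invr_gt0 ltr0n prime_gt0.
  rewrite -div1r ler_pdivrMr; last by lra.
  by move: (p%:R^-1) u0 u2 zs => u; nra.
have h2 : (1 - x p * z p)^-1 <= expR (4 / p%:R).
  by rewrite (le_trans _ h1)// lef_pV2 ?posrE; case: (x01 p) => e; rewrite ?e; lra.
have -> : 8 / p%:R = 4 / p%:R + 4 / p%:R :> R by rewrite -mulrDl; congr (_ / _); lra.
rewrite expRD; apply: ler_pM => //; rewrite invr_ge0; first by lra.
by case: (x01 p) => e; rewrite ?e; lra.
Qed.

(** The sum of [1/p] over [p <= q] is bounded crudely by the harmonic number; a fixed power of [q],
    here [e^8 * q^8], is good enough for Rankin's trick. *)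
Lemma sum_smooth_weighted N :
  \sum_(1 <= n < N | smooth q.+1 n) lam x n / n%:R * w n <= expR (8 * (1 + ln q%:R)).
Proof.
apply: (@le_trans _ _ (\prod_(p < q.+1 | prime p) local_factor (z p) (x p))).
  apply: (@sum_smooth_le_prod R (fun n => lam x n / n%:R * w n)
     _ _ _ (fun p => local_factor (z p) (x p))).
  - by rewrite lam1// divr1 mul1r /w ln1 mulr0 expR0.
  - move=> p n k pp n0 pn; have pk : (0 < p ^ k)%N by rewrite expn_gt0 prime_gt0.
    rewrite lam_divM// (wM n0 pk).
    by rewrite mulrACA.
  - by move=> n n0; rewrite mulr_ge0 ?lam_div_ge0 ?expR_ge0.
  - move=> p K pp.
    have E k : lam x (p ^ k) / (p ^ k)%:R * w (p ^ k) =
        (\sum_(i < k.+1) x p ^+ i) * z p ^+ k.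
      by rewrite lam_div_ppow// wX ?prime_gt0// -mulrA -exprMn [_^-1 * _]mulrC.
    under eq_bigr do rewrite E.
    by apply: local_factor_le => //; exact: z_bounds.
apply: (@le_trans _ _ (\prod_(p < q.+1 | prime p) expR (8 / p%:R))).
  apply: ler_prod => p pp; rewrite z_factor//; last by rewrite -ltnS.
  by rewrite andbT ltW// local_factor_gt0// z_bounds.
rewrite -expR_sum ler_expR -mulr_sumr ler_pM2l//.
rewrite (le_trans _ (harmonic_number_le R (m := q) _))//; last by rewrite (leq_trans _ q3).
rewrite -(big_mkord (fun p => prime p) (fun p => p%:R^-1)) /harmonic_number.
rewrite big_mkcond big_nat_recl//= add0r big_add1.
by apply: ler_sum => p _; case: ifP => // _; rewrite invr_ge0.
Qed.

(** Beyond [q^b] the weight is at least [exp(b / 4)], so the tail is at most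
    [e^8 * q^8 * exp(- b / 4)]. Asking for [e^8 / q] means [b / 4 >= 9 ln q], whence the 36. *)
Lemma sum_smooth_tail (b N : nat) : 36 * @ln R q%:R <= b%:R ->
  \sum_(1 <= n < N | smooth q.+1 n) lam x n / n%:R <=
  \sum_(1 <= n < (q ^ b).+1) lam x n / n%:R + expR 8 / q%:R.
Proof.
move=> hb; have q0 : (0 : R) < q%:R by rewrite ltr0n (leq_trans _ q3).
rewrite (bigID (fun n => (n <= q ^ b)%N)) /=; apply: lerD.
  rewrite -big_filter; apply: (@ler_sum_subset R nat _ predT).
  - by rewrite filter_uniq// iota_uniq.
  - exact: iota_uniq.
  - move=> n; rewrite mem_filter mem_index_iota => /andP[/andP[_ nb] /andP[n0 _]].
    by rewrite mem_index_iota n0 ltnS.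
  - by move=> n; rewrite mem_index_iota => /andP[n0 _]; rewrite lam_div_ge0.
apply: (@le_trans _ _ (expR (- (b%:R / 4)) *
   \sum_(1 <= n < N | smooth q.+1 n) lam x n / n%:R * w n)).
  rewrite mulr_sumr [leLHS]big_mkcondr /= big_nat_cond [leRHS]big_nat_cond.
  apply: ler_sum => n /andP[/andP[n0 _] _].
  have l0 := lam_div_ge0 xM x1 x01 n0.
  case: ifPn => nb; last first.
    exact: mulr_ge0 (expR_ge0 _) (mulr_ge0 l0 (expR_ge0 _)).
  rewrite mulrCA ler_peMr// -expRD -[leLHS]expR0 ler_expR.
  rewrite -ltnNge in nb.
  have : ln ((q ^ b)%:R : R) <= ln n%:R.
    by rewrite ler_ln ?posrE ?ltr0n ?expn_gt0 ?(leq_trans _ q3)// ler_nat ltnW.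
  rewrite natrX lnXn// -[ln _ *+ b]mulr_natl => h.
  have : d * (b%:R * ln q%:R) <= d * ln n%:R by rewrite ler_pM2l// d_gt0.
  have -> : d * (b%:R * ln q%:R) = b%:R / 4 by rewrite /d; field; rewrite gt_eqF// (lt_le_trans ltr01).
  lra.
rewrite (le_trans (ler_wpM2l (expR_ge0 _) (sum_smooth_weighted N)))//.
rewrite -expRD -[in leRHS](lnK (x := q%:R)) ?posrE// -expRN -expRD ler_expR; lra.
Qed.

Lemma prod_euler_factor_le (b : nat) : 36 * @ln R q%:R <= b%:R ->
  \prod_(p < q.+1 | prime p) euler_factor p <=
  \sum_(1 <= n < (q ^ b).+1) lam x n / n%:R + expR 8 / q%:R.
Proof.
move=> hb; apply: (@prod_le_of_sum_smooth R (fun n => lam x n / n%:R)).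
- by rewrite lam1// divr1.
- by move=> p n k pp n0 pn; exact: lam_divM.
- by move=> n n0; exact: lam_div_ge0.
- move=> p pp; under eq_fun do under eq_bigr do rewrite lam_div_ppow//.
  by apply: cvg_local_factor => //; exact: prime_inv_bounds.
- by move=> N; exact: sum_smooth_tail.
Qed.

End Rankin.
End SmoothTruncation.

(** * The truncated Euler product of zeta(2) *)

Section ZetaTwoProduct.
Variables (R : realType) (q : nat).
Hypothesis q0 : (0 < q)%N.

Let f (n : nat) : R := (n%:R ^+ 2)^-1.

(** The sum of [0 ^+ i] is 1, from [i = 0]; written this way, [n^(-2)] has the local factor with
    [t = 0]. *)
Let fE p k : f (p ^ k) = (\sum_(i < k.+1) 0 ^+ i) * ((p%:R ^+ 2)^-1) ^+ k.
Proof.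
rewrite big_ord_recl expr0 big1 ?addr0 ?mul1r; last by move=> i _; rewrite expr0n.
by rewrite /f natrX exprVn -!exprM mulnC.
Qed.

Let fM p n k : prime p -> (0 < n)%N -> ~~ (p %| n)%N -> f (n * p ^ k) = f n * f (p ^ k).
Proof. by move=> *; rewrite /f natrM exprMn invfM. Qed.

Let fb p : prime p -> 0 <= f p < 1.
Proof.
move=> pp; rewrite /f invr_ge0 sqr_ge0/= invf_lt1 ?exprn_gt0 ?ltr0n ?prime_gt0//.
by rewrite expr_gt1 ?ltr1n ?prime_gt1.
Qed.

Definition zeta2_factor (p : nat) : R := (1 - (p%:R ^+ 2)^-1)^-1.

Let factorE p : local_factor (f p) 0 = zeta2_factor p.
Proof. by rewrite /local_factor mul0r subr0 invr1 mulr1. Qed.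

Lemma zeta2_prod_bounds :
  pi ^+ 2 / 6 - q%:R^-1 <= \prod_(p < q.+1 | prime p) zeta2_factor p <= pi ^+ 2 / 6.
Proof.
have f1 : f 1 = 1 by rewrite /f expr1n invr1.
have f0 n : (0 < n)%N -> 0 <= f n by rewrite /f invr_ge0 sqr_ge0.
apply/andP; split.
  rewrite lerBlDr; have /andP[_ h] := basel R q0; apply: (le_trans h); rewrite lerD2r.
  rewrite (_ : zeta2_partial R q = \sum_(1 <= n < q.+1 | smooth q.+1 n) f n).
    apply: (sum_smooth_le_prod f1 fM f0) => p K pp.
    under eq_bigr do rewrite fE.
    by rewrite -factorE; apply: local_factor_le; [exact: Or31|exact: fb].
  rewrite /zeta2_partial big_nat [RHS]big_nat_cond; apply: eq_big => n; last by [].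
  apply/idP/idP => [nM|/andP[]//]; rewrite nM /=.
  case/andP: nM => n0 nM; apply/smoothP => // p pp /dvdn_leq -/(_ n0) pn.
  exact: leq_ltn_trans nM.
apply: (prod_le_of_sum_smooth f1 fM f0) => [p pp|N].
  under eq_fun do under eq_bigr do rewrite fE.
  by rewrite -factorE; apply: cvg_local_factor; [exact: Or31|exact: fb].
apply: (@le_trans _ _ (zeta2_partial R N.+1)); last by case/andP: (basel R (ltn0Sn N)).
rewrite /zeta2_partial -big_filter; apply: (@ler_sum_subset R nat _ predT).
- by rewrite filter_uniq// iota_uniq.
- exact: iota_uniq.
- move=> n; rewrite mem_filter !mem_index_iota => /and3P[_ -> nN]; split => //=.
  by rewrite ltnS (leq_trans (ltnW nN)).
- by move=> n; rewrite mem_index_iota => /andP[n0 _]; exact: f0.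
Qed.

End ZetaTwoProduct.

(** * Small L(1, chi) *)

Section ExceptionalEstimates.
Variable R : realType.

(** One term of the exponential series at [ln q]; it converts errors in [1/q] into powers of
    [1 / ln q]. *)
Lemma pow_ln_div_le (k : nat) : exists2 C : R, 0 < C &
  forall q : nat, (3 <= q)%N -> (q%:R^-1 : R) <= C * (ln q%:R)^-1 ^+ k.+1.
Proof.
exists (k.+1)`!%:R => [|q q3]; first by rewrite ltr0n fact_gt0.
have q1 : (0 < q)%N by exact: leq_trans q3.
have q0 : (0 : R) < q%:R by rewrite ltr0n.
have l0 : 0 < ln (q%:R : R) by rewrite ln_gt0// ltr1n (leq_trans _ q3).
have := expR_ge1Dxn k (ltW l0); rewrite lnK ?posrE// => h.
have {}h : ln q%:R ^+ k.+1 / (k.+1)`!%:R <= q%:R :> R by lra.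
rewrite exprVn -[leRHS]invf_div lef_pV2 ?posrE ?divr_gt0 ?exprn_gt0 ?ltr0n ?fact_gt0//.
Qed.

Lemma ln_ge1 (q : nat) : (3 <= q)%N -> 1 <= ln q%:R :> R.
Proof.
move=> q3; rewrite -[leLHS]expRK ler_ln ?posrE ?expR_gt0 ?ltr0n ?(leq_trans _ q3)//.
by rewrite (le_trans (expR1_le3 R))// ler_nat.
Qed.

Variable A : R.
Hypothesis A0 : 0 < A.

(* [L1] and [Lp] stand for L(1, chi) and L'(1, chi). *)
Definition exceptional (q : nat) (x : nat -> R) (L1 Lp : R) :=
  [/\ (3 <= q)%N,
      forall m n, x (m * n)%N = x m * x n,
      x 1%N = 1,
      forall n, [\/ x n = 0, x n = 1 | x n = -1] &
      L1 <= A * (ln q%:R)^-1 ^+ 26 /\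
      exists2 gam : R, `|gam| <= 2 & forall N, (q ^ 3 <= N)%N ->
      `|\sum_(1 <= n < N.+1) lam x n / n%:R - (L1 * (ln N%:R + gam) + Lp)| <=
      50 * ln q%:R * ln N%:R / q%:R].

Lemma exceptional_tail : exists2 C : R, 0 < C & forall q x L1 Lp,
  exceptional q x L1 Lp -> let i := (ln q%:R)^-1 in
  [/\ forall M N, (q ^ 3 <= M)%N -> (M <= N)%N ->
      \sum_(M.+1 <= n < N.+1) lam x n / n%:R <= C * i ^+ 8 * ln N%:R,
      q%:R^-1 <= C * i &
      `|Lp - \sum_(1 <= n < (q ^ 4).+1) lam x n / n%:R| <= C * i].
Proof.
(* The lemma gives exponent 9; the factor [ln q] in the error of the asymptotics leaves [i ^+ 8].
   This covers the later losses: [ln (q^b) = O(ln^2 q)] in [exceptional_euler] and the fourth root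
   in [exceptional_prime_sum]. *)
have [K K0 Kq] := pow_ln_div_le 8.
exists (6 * A + 1100 * K) => [|q x L1 Lp]; first by move: A0; lra.
move=> [q3 xM x1 x01 [hL [gam gam2 asy]]] i.
have l1 := ln_ge1 q3; have q0 : (0 < q)%N by exact: leq_trans q3.
have hq : q%:R^-1 <= K * i ^+ 9 := Kq _ q3.
have u0 : 0 < (q%:R^-1 : R) by rewrite invr_gt0 ltr0n.
have lnX k : ln ((q ^ k)%:R : R) = k%:R * ln q%:R.
  by rewrite natrX lnXn ?ltr0n// mulr_natl.
have leX j k : (j <= k)%N -> (q ^ j <= q ^ k)%N by move=> jk; rewrite leq_pexp2l.
move: u0 hq hL asy lnX; rewrite -/i.
set u : R := q%:R^-1; have li : ln q%:R * i = 1 by rewrite divff// gt_eqF//; lra.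
have i0 : 0 < i by rewrite invr_gt0; lra.
have i1 : i <= 1 by rewrite invf_le1//; lra.
move: (ln q%:R : R) l1 li => l l1 li u0 hq hL asy lnX.
have ile a b : (a <= b)%N -> i ^+ b <= i ^+ a.
  by move=> ab; apply: ler_wiXn2l => //; exact: ltW.
have ige a : 0 < i ^+ a by rewrite exprn_gt0.
have hlu : l * u <= K * i ^+ 8.
  have -> : K * i ^+ 8 = l * (K * i ^+ 9) by rewrite (exprS i 8) -[LHS]mul1r -li; ring.
  by rewrite ler_pM2l//; lra.
have bound M N : (q ^ 3 <= M)%N -> (M <= N)%N ->
    \sum_(M.+1 <= n < N.+1) lam x n / n%:R <=
    L1 * (ln N%:R - ln M%:R) + 50 * (K * i ^+ 8) * (ln M%:R + ln N%:R).
  move=> qM MN; rewrite -sum_range_cat//.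
  have M0 : (0 < M)%N by rewrite (leq_trans _ qM)// expn_gt0 q0.
  have lM : 0 <= ln (M%:R : R) by rewrite ln_ge0// ler1n.
  have lN : 0 <= ln (N%:R : R) by rewrite ln_ge0// ler1n (leq_trans M0).
  have := asy _ qM; have := asy _ (leq_trans qM MN); rewrite -/u.
  set S := \sum_(_ <= _ < _) _; set T := \sum_(_ <= _ < _) _.
  move: (ln M%:R) (ln N%:R) lM lN => a b a0 b0; rewrite !ler_norml.
  have := ler_wpM2r a0 hlu; have := ler_wpM2r b0 hlu; lra.
(* The increment of [S] from [q^3] to [q^6] is nonnegative and at most
   [3 l * L1 + 50 * K * i^8 * 9 l]; dividing by [3 l] gives 150. *)
have hL' : - (150 * K * i ^+ 8) <= L1.
  have := bound (q ^ 3)%N (q ^ 6)%N (leqnn _) (leX 3 6 isT).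
  rewrite !lnX => h.
  have S0 : 0 <= \sum_((q ^ 3).+1 <= n < (q ^ 6).+1) lam x n / n%:R.
    rewrite big_nat; apply: sumr_ge0 => n /andP[n0 _].
    by rewrite lam_div_ge0// (leq_trans _ n0).
  have l0 : 0 < 3 * l by lra.
  by rewrite -(ler_pM2r l0); move: (le_trans S0 h); lra.
have hLA : L1 <= A * i ^+ 8 by rewrite (le_trans hL)// ler_pM2l// ile.
split.
- move=> M N qM MN; apply: (le_trans (bound _ _ qM MN)).
  have M0 : (0 < M)%N by rewrite (leq_trans _ qM)// expn_gt0 q0.
  have lM : 0 <= ln (M%:R : R) by rewrite ln_ge0// ler1n.
  have MN' : ln M%:R <= ln N%:R :> R.
    by rewrite ler_ln ?posrE ?ler_nat ?ltr0n// (leq_trans M0).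
  move: (ln M%:R) (ln N%:R) lM MN' => a b a0 ab.
  clear - A0 K0 ige a0 ab hLA.
  have d0 : 0 <= b - a by rewrite subr_ge0.
  have h1 := ler_wpM2r d0 hLA.
  have Ai : 0 <= A * i ^+ 8 by rewrite mulr_ge0// ltW.
  have Ki : 0 <= K * i ^+ 8 by rewrite mulr_ge0// ltW.
  have h2 := mulr_ge0 Ai a0; have h3 := mulr_ge0 Ki d0.
  have b0 : 0 <= b := le_trans a0 ab.
  have h4 := mulr_ge0 Ai b0; have h5 := mulr_ge0 Ki b0; lra.
- have := ile 1%N 9%N isT; rewrite expr1 => h.
  have := ler_wpM2l (ltW K0) h; have := mulr_ge0 (ltW A0) (ltW i0).
  have := mulr_ge0 (ltW K0) (ltW i0); lra.
have := asy _ (leX 3 4 isT); rewrite lnX -/u.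
set S := \sum_(_ <= _ < _) _ => hS.
have e1 : 50 * l * (4%:R * l) * u <= 200 * K * i.
  have h : l * (l * u) <= K * i.
    have l0 : 0 <= l by lra.
    apply: (le_trans (ler_wpM2l l0 hlu)).
    have -> : l * (K * i ^+ 8) = K * i ^+ 7.
      by rewrite (exprS i 7) -[RHS]mul1r -li; ring.
    by rewrite ler_pM2l// -[leRHS]expr1 ile.
  lra.
have e2 : `|L1 * (4%:R * l + gam)| <= (A + 150 * K) * 6 * i.
  rewrite normrM.
  have h1 : `|L1| <= (A + 150 * K) * i ^+ 8.
    have := mulr_gt0 A0 (ige 8%N); have := mulr_gt0 K0 (ige 8%N).
    by rewrite ler_norml; lra.
  have h2 : `|4%:R * l + gam| <= 6 * l by move: gam2; rewrite !ler_norml; lra.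
  apply: (le_trans (ler_pM _ _ h1 h2)) => //.
  have -> : (A + 150 * K) * i ^+ 8 * (6 * l) = (A + 150 * K) * 6 * i ^+ 7.
    by rewrite (exprS i 7) -[RHS]mul1r -li; ring.
  by rewrite ler_wpM2l ?mulr_ge0 ?addr_ge0 ?mulr_ge0 ?(ltW A0) ?(ltW K0)// -[leRHS]expr1 ile.
move: hS e2; rewrite !ler_norml; lra.
Qed.

Lemma exceptional_prime_sum : exists2 C : R, 0 < C & forall q x L1 Lp,
  exceptional q x L1 Lp -> 0 <= lam_prime_sum x q (q ^ 4) <= C * (ln q%:R)^-1.
Proof.
have [C C0 tail] := exceptional_tail.
pose D : R := 34 ^+ 4 * (C * 17).
have D0 : 0 < D by rewrite mulr_gt0 ?exprn_gt0 ?mulr_gt0.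
(* Adding 1 gives [D <= (D + 1)^4], so fourth powers can be compared without extracting a root of
   [D]. *)
exists (D + 1) => [|q x L1 Lp exc]; first by rewrite addr_gt0.
have [tl _ _] := tail _ _ _ _ exc; case: exc => q3 xM x1 x01 _.
have q0 : (0 < q)%N by exact: leq_trans q3.
have l1 := ln_ge1 q3.
set i := (ln q%:R)^-1 in tl *.
have i0 : 0 < i by rewrite invr_gt0; lra.
have i1 : i <= 1 by rewrite invf_le1//; lra.
have Q0 : 0 <= lam_prime_sum x q (q ^ 4).
  rewrite /lam_prime_sum big_nat_cond; apply: sumr_ge0 => p /andP[/andP[qp _] _].
  by rewrite lam_div_ge0// (leq_trans _ qp).
rewrite Q0/= -(@ler_pXn2r _ 4)// ?nnegrE//; last by rewrite mulr_ge0 ?addr_ge0 ?ltW.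
have q1 : (1 < q)%N by exact: leq_trans q3.
apply: (le_trans (lam_prime_sum_pow4 xM x1 x01 q1)).
(* The tail estimate starts at [M.+1], so it is applied with [M = q^4 - 1], still at least [q^3]. *)
have q3' : (q ^ 3 <= (q ^ 4).-1)%N.
  rewrite -ltnS prednK ?expn_gt0 ?q0//.
  by rewrite ltn_exp2l.
have N0 : (0 < 2 * q ^ 16)%N by rewrite muln_gt0 expn_gt0 q0.
have MN : ((q ^ 4).-1 <= (2 * q ^ 16).-1)%N.
  rewrite -ltnS (prednK N0) prednK ?expn_gt0 ?q0//.
  by rewrite (leq_trans (n := q ^ 16))// ?leq_pmull// leq_pexp2l.
have := tl _ _ q3' MN; rewrite !prednK ?expn_gt0 ?q0// => h.
have hl : ln ((2 * q ^ 16).-1%:R : R) <= 17 * ln q%:R.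
  have -> : 17 * ln q%:R = ln ((q ^ 17)%:R) :> R.
    by rewrite natrX lnXn ?ltr0n// mulr_natl.
  rewrite ler_ln ?posrE ?ltr0n ?expn_gt0 ?q0//; last first.
    by rewrite -ltnS prednK// (leq_trans (_ : 2 <= 2 * 1)%N)// leq_mul2l expn_gt0 q0.
  rewrite ler_nat (leq_trans (leq_pred _))// (expnS q 16) leq_mul2r.
  by rewrite ltnW ?orbT// (leq_trans _ q3).
have Ci8 : 0 <= C * i ^+ 8 by rewrite mulr_ge0 ?exprn_ge0 ?ltW.
have {}h := le_trans h (ler_wpM2l Ci8 hl).
have P0 : 0 < 34 ^+ 4 :> R by rewrite exprn_gt0.
apply: (le_trans (ler_wpM2l (ltW P0) h)).
have li : ln q%:R * i = 1 by rewrite divff// gt_eqF//; lra.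
have -> : 34 ^+ 4 * (C * i ^+ 8 * (17 * ln q%:R)) = D * i ^+ 7 * (ln q%:R * i).
  by rewrite /D; ring.
rewrite li mulr1.
rewrite exprMn; apply: ler_pM; rewrite ?exprn_ge0 ?(ltW D0) ?(ltW i0)//.
  have h1 : D + 1 <= (D + 1) ^+ 4 by rewrite -[leLHS]expr1 ler_weXn2l//; lra.
  lra.
by apply: ler_wiXn2l => //; exact: ltW.
Qed.

Lemma exceptional_euler : exists2 C : R, 0 < C & forall q x L1 Lp,
  exceptional q x L1 Lp -> let i := (ln q%:R)^-1 in
  let P := \prod_(p < q.+1 | prime p) euler_factor x p in
  [/\ q%:R^-1 <= C * i, P * (1 - C * i) <= Lp & Lp <= P * (1 + C * i)].
Proof.
have [C C0 tail] := exceptional_tail.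
have [D D0 primesum] := exceptional_prime_sum.
pose E := 2 * D + 2 * C.
have E0 : 0 < E by rewrite addr_gt0 ?mulr_gt0.
(* [42 * C] covers the growth [40 * C * i] of the sum from [q^4] to [q^b] and the error [C * i] in
   [hLp]; [expR 8 * C] is Rankin's tail, and [E * expR E] comes from [expR y - 1] with
   [y <= E * i]. *)
pose F := 42 * C + expR 8 * C + E * expR E.
have e8 : 0 < expR 8 * C by rewrite mulr_gt0 ?expR_gt0.
have eE : 0 < E * expR E by rewrite mulr_gt0 ?expR_gt0.
exists F => [|q x L1 Lp exc i P]; first by rewrite /F; lra.
have [tl qi hLp] := tail _ _ _ _ exc.
have /andP[Q0 Qi] := primesum _ _ _ _ exc.
case: exc => q3 xM x1 x01 _.
have q0 : (0 < q)%N by exact: leq_trans q3.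
have u0 : 0 < (q%:R^-1 : R) by rewrite invr_gt0 ltr0n.
have l1 := ln_ge1 q3.
rewrite -/i in tl qi hLp Qi.
have i0 : 0 < i by rewrite invr_gt0; lra.
have i1 : i <= 1 by rewrite invf_le1//; lra.
have li : ln q%:R * i = 1 by rewrite divff// gt_eqF//; lra.
have Ci := mulr_gt0 C0 i0; have e8i := mulr_gt0 e8 i0; have eEi := mulr_gt0 eE i0.
have P1 : 1 <= P.
  rewrite /P; elim/big_ind: _ => [//|a b a1 b1|p pp]; last exact: euler_factor_ge1.
  by rewrite mulr_ege1.
have up := sum_lam_le_prod xM x1 x01 q0; rewrite -/P in up.
set S := \sum_(1 <= _ < (q ^ 4).+1) _ in up hLp.
set y := 2 * lam_prime_sum _ _ _ + 2 / q%:R in up.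
have yE : y <= E * i by rewrite /y /E; lra.
have y0 : 0 <= y by rewrite /y; lra.
have ey : expR y <= 1 + E * expR E * i.
  have h := expRB1_le y.
  have Ei : E * i <= E by rewrite ler_piMr// ltW.
  have h2 : expR y <= expR E by rewrite ler_expR; lra.
  have : y * expR y <= (E * i) * expR E by rewrite ler_pM ?expR_ge0.
  lra.
(* An integer just above [36 ln q], as Rankin's tail requires; since [ln q >= 1] it is also at most
   [40 ln q]. *)
pose b := (Num.truncn (36 * ln (q%:R : R))).+1.
have b0 : 0 <= 36 * ln (q%:R : R) by lra.
have /andP[b1 b2] := truncn_itv b0.
have hb : 36 * ln q%:R <= b%:R :> R by exact: ltW.
have lo := prod_euler_factor_le xM x1 x01 q3 l1 hb; rewrite -/P in lo.
have b4 : (4 <= b)%N.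
  have : (4 : R) <= b%:R by lra.
  by rewrite ler_nat.
have qM : (q ^ 3 <= q ^ 4)%N by rewrite leq_pexp2l.
have MN : (q ^ 4 <= q ^ b)%N by rewrite leq_pexp2l.
have := tl _ _ qM MN; rewrite -sum_range_cat// -/S => h.
have hlb : C * i ^+ 8 * ln (q ^ b)%:R <= 40 * C * i.
  rewrite natrX lnXn ?ltr0n// -[ln _ *+ b]mulr_natl.
  have h1 : b%:R * ln q%:R <= (40 * ln q%:R) * ln q%:R :> R.
    rewrite ler_wpM2r//; first by lra.
    rewrite /b -natr1; lra.
  have Ci8 : 0 <= C * i ^+ 8 by rewrite mulr_ge0 ?exprn_ge0 ?ltW.
  apply: (le_trans (ler_wpM2l Ci8 h1)).
  have -> : C * i ^+ 8 * (40 * ln q%:R * ln q%:R) =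
      40 * C * i ^+ 6 * (ln q%:R * i) ^+ 2 by ring.
  rewrite li expr1n mulr1.
  rewrite ler_wpM2l ?mulr_ge0 ?(ltW C0)// -[leRHS]expr1.
  by apply: ler_wiXn2l => //; exact: ltW.
have h8 : expR 8 / q%:R <= expR 8 * C * i.
  by rewrite -mulrA ler_pM2l ?expR_gt0.
(* Since [P >= 1], absolute errors are also errors relative to [P]. *)
have PFi : forall c, 0 <= c -> c <= c * P by move=> c c0; rewrite ler_peMr.
have PC := PFi _ (ltW Ci); have Pe8 := PFi _ (ltW e8i); have PE := PFi _ (ltW eEi).
have P0 : 0 <= P := le_trans ler01 P1.
clear - C0 hLp qi up lo h hlb h8 ey P1 PC Pe8 PE Ci e8i eEi P0 i0.
split.
- by rewrite /F; lra.
- have hPe := mulr_ge0 P0 (ltW eEi).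
  by move: hLp; rewrite ler_norml /F; lra.
have := ler_wpM2l P0 ey.
have hPe := mulr_ge0 P0 (ltW e8i); have hPC := mulr_ge0 P0 (ltW Ci).
by move: hLp; rewrite ler_norml /F; lra.
Qed.

End ExceptionalEstimates.

(** * Splitting the Euler product and conclusion *)

Section EulerFactorSplitting.
Variables (R : realType) (q : nat) (x : nat -> R).
Hypothesis x01 : forall n, [\/ x n = 0, x n = 1 | x n = -1].
Hypothesis xq : forall n, (x n == 0) = ~~ coprime n q.

(** With [u = 1/p], taking [1 / (1 - u^2)] out of the Euler factor leaves [1 + u] when [x p = 0],
    that is [p] divides [q]; [(1 + u) / (1 - u)] when [x p = 1]; and 1 when [x p = -1]. *)
Lemma euler_factor_split p : prime p -> euler_factor x p =
  (if (p %| q)%N then 1 + p%:R^-1 else 1) *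
  (if x p == 1 then (1 + p%:R^-1) * (1 - p%:R^-1)^-1 else 1) * zeta2_factor R p.
Proof.
move=> pp; have := xq p; rewrite prime_coprime// negbK => <-.
rewrite /euler_factor /local_factor /zeta2_factor -exprVn.
have /andP[u0 u1] := prime_inv_bounds R pp; move: p%:R^-1 u0 u1 => u u0 u1.
have -> : 1 - u ^+ 2 = (1 - u) * (1 + u) by ring.
have n1 : 1 - u != 0 by rewrite gt_eqF//; lra.
have n2 : 1 + u != 0 by rewrite gt_eqF//; lra.
have N1 : (-1 == 1 :> R) = false by rewrite lt_eqF//; lra.
have N0 : (-1 == 0 :> R) = false by rewrite oppr_eq0 oner_eq0.
case: (x01 p) => ->; rewrite ?eqxx ?oner_eq0 ?N1 ?N0 1?eq_sym ?oner_eq0.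
- by field; rewrite n1 n2.
- by field; rewrite n1 n2.
- by field; rewrite n1 n2.
Qed.

Lemma prod_euler_factor_split :
  \prod_(p < q.+1 | prime p) euler_factor x p =
  (\prod_(p < q.+1 | prime p && (p %| q)%N) (1 + p%:R^-1)) *
  (\prod_(p < q.+1 | prime p && (x p == 1)) ((1 + p%:R^-1) * (1 - p%:R^-1)^-1)) *
  \prod_(p < q.+1 | prime p) zeta2_factor R p.
Proof.
rewrite !big_mkcondr -!big_split /=; apply: eq_bigr => p pp.
exact: euler_factor_split.
Qed.

End EulerFactorSplitting.

(** Here [G] is [pi^2 / 6], [Z] its truncated Euler product, [a] and [b] the two products of the
    theorem, [u = 1/q], [i = 1 / ln q] and [w] the final error scale. Since [Z >= 1], the gap
    [G - Z <= u] is a relative error, and it adds a second [C * i] in the lower bound. *)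
Lemma relative_error (R : realFieldType) (G a b Z u i w C Lp : R) :
  1 <= Z -> 1 <= a -> 1 <= b -> 0 <= u -> G - u <= Z -> Z <= G -> u <= C * i ->
  a * b * Z * (1 - C * i) <= Lp -> Lp <= a * b * Z * (1 + C * i) ->
  0 <= i -> i <= w -> 0 < C ->
  exists2 theta, `|theta| <= 2 * C * w & Lp = G * a * b * (1 + theta).
Proof.
move=> Z1 a1 b1 u0 GZ ZG uC lo hi i0 iw C0.
have ab1 : 1 <= a * b by rewrite mulr_ege1.
have Ci : 0 <= C * i by rewrite mulr_ge0// ltW.
have P0 : 0 < G * a * b by rewrite !mulr_gt0//; lra.
have PE : G * a * b = a * b * G by ring.
have h1 : a * b * Z <= G * a * b by rewrite PE ler_pM2l//; lra.
have h2 : G * a * b <= a * b * Z * (1 + u).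
  rewrite PE -[leRHS]mulrA ler_pM2l; last by lra.
  have : u * 1 <= u * Z by rewrite ler_wpM2l.
  lra.
have Pp : 0 < a * b * Z by rewrite mulr_gt0//; lra.
exists (Lp / (G * a * b) - 1); last by rewrite addrC subrK mulrC mulfVK// gt_eqF.
have Ciw : C * i <= C * w by rewrite ler_pM2l.
have up : Lp <= (1 + C * i) * (G * a * b).
  rewrite (le_trans hi)// mulrC; apply: ler_wpM2l => //; lra.
have dn : (1 - 2 * (C * i)) * (G * a * b) <= Lp.
  have e1 : a * b * Z * u <= G * a * b * (C * i) by rewrite ler_pM// ltW.
  have e2 : a * b * Z * (C * i) <= G * a * b * (C * i) by rewrite ler_wpM2r.
  lra.
rewrite ler_norml; apply/andP; split.
  have : 1 - 2 * (C * i) <= Lp / (G * a * b) by rewrite ler_pdivlMr.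
  lra.
have : Lp / (G * a * b) <= 1 + C * i by rewrite ler_pdivrMr.
lra.
Qed.

Theorem theorem1p1 (R : realType) (A : R) (hA : 0 < A) :
  exists2 C : R, 0 < C &
    forall (q : nat) (chi : nat -> R[i]),
      primitive_character q chi -> quadratic_character q chi ->
      dirichlet_L chi 1 <= (A * (ln q%:R) ^- 26)%:C ->
      exists2 theta : R, `|theta| <= C * (ln q%:R) `^ (- 10^-1) &
        dirichlet_L' chi 1 =
          (pi ^+ 2 / 6
           * (\prod_(p < q.+1 | prime p && (p %| q)%N) (1 + p%:R^-1))
           * (\prod_(p < q.+1 | prime p && (chi p == 1))
                ((1 + p%:R^-1) * (1 - p%:R^-1)^-1))
           * (1 + theta))%:C.
Proof.
have [C C0 main] := exceptional_euler hA.
exists (2 * C) => [|q chi _ qchi]; first by rewrite mulr_gt0.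
have q3 := quadratic_modulus_ge3 qchi.
have q0 : (0 < q)%N by exact: leq_trans q3.
have xM := real_characterM qchi; have x1 := real_character1 qchi.
have x01 := real_character_values qchi.
have xB := sum_real_character_bound qchi.
have [L1 cL1 L1b] := cvg_series_inv xB.
have [Ll cLl Llb] := cvg_series_ln xB.
have [gam gam2 gamb] := euler_constant R.
have EL := dirichlet_L1E xB cL1 cLl; have EL' := dirichlet_L'1E xB cL1 cLl.
rewrite -(real_characterE qchi) in EL EL'.
rewrite EL EL' lecR => hL1.
have x_le1 n : `|real_character chi n| <= 1.
  by case: (x01 n) => ->; rewrite ?normrN ?normr0 ?normr1.
have exc : exceptional A q (real_character chi) L1 (- Ll).
  split => //; split; first by rewrite exprVn.
  exists gam => // N qN.
  exact: (sum_lam_asymptotics xB x_le1 q3 L1b Llb gam2 gamb qN).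
have [] := main _ _ _ _ exc; rewrite prod_euler_factor_split//; last first.
  exact: real_character_eq0.
have -> : \prod_(p < q.+1 | prime p && (chi p == 1)) ((1 + p%:R^-1) * (1 - p%:R^-1)^-1) =
    \prod_(p < q.+1 | prime p && (real_character chi p == 1))
      ((1 + p%:R^-1) * (1 - p%:R^-1)^-1) :> R.
  by apply: eq_bigl => p; rewrite (real_character_eq1 qchi).
have inv_bounds p : prime p -> 0 <= (p%:R^-1 : R) < 1 := @prime_inv_bounds R p.
have /andP[Zlo Zhi] := zeta2_prod_bounds R q0.
have Z1 : 1 <= \prod_(p < q.+1 | prime p) zeta2_factor R p.
  elim/big_ind: _ => [//|a b a1 b1|p pp]; first by rewrite mulr_ege1.
  have /andP[u0 u1] := inv_bounds _ pp; rewrite /zeta2_factor -exprVn.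
  move: p%:R^-1 u0 u1 => u u0 u1; have u2 : u ^+ 2 < 1 by rewrite expr_lt1.
  by rewrite invf_ge1; have := sqr_ge0 u; lra.
have A1 : 1 <= \prod_(p < q.+1 | prime p && (p %| q)%N) (1 + p%:R^-1) :> R.
  elim/big_ind: _ => [//|a b a1 b1|p /andP[pp _]]; first by rewrite mulr_ege1.
  by rewrite lerDl invr_ge0.
have B1 : 1 <= \prod_(p < q.+1 | prime p && (real_character chi p == 1))
    ((1 + p%:R^-1) * (1 - p%:R^-1)^-1) :> R.
  elim/big_ind: _ => [//|a b a1 b1|p /andP[pp _]]; first by rewrite mulr_ege1.
  have /andP[u0 u1] := inv_bounds _ pp; move: p%:R^-1 u0 u1 => u u0 u1.
  by rewrite mulr_ege1 ?invf_ge1; lra.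
have l1 := ln_ge1 R q3.
have u0 : 0 <= (q%:R^-1 : R) by rewrite invr_ge0.
(* The estimates give a relative error [O(1 / ln q)]; as [ln q >= 1], this is within the exponent
   [-1/10]. *)
have ipow : (ln q%:R)^-1 <= ln q%:R `^ (- 10^-1) :> R.
  rewrite -powR_inv1; last by lra.
  by apply: ler_powR => //; lra.
have i0 : 0 <= (ln q%:R)^-1 :> R by rewrite invr_ge0; lra.
move=> uC lo hi.
have [theta th eth] := relative_error Z1 A1 B1 u0 Zlo Zhi uC lo hi i0 ipow C0.
by exists theta => //; rewrite eth.
Qed.
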